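(* Let $U\subset\mathbb R^d$ be open and $\mathbf f:U\to\mathbb R^n$ continuous and good. The following are equivalent: (i) the set $\{\mathbf x\in U:\mathbf f(\mathbf x)\text{ is not VWA}\}$ is dense in $U$; (ii) $\mathbf f$ is extremal; (iii) for a.e. $\mathbf x_0\in U$ and every $r>0$ there is a ball $B\subset U$ centered at $\mathbf x_0$ of radius less than $r$ satisfying condition ( * ); (iv) every ball $B\subset U$ satisfies condition ( * ). Here condition ( * ) for a ball $B$ is: for every $\beta>0$ there exists $T>0$ such that for every $t\ge T$ and every $\Gamma\in\mathcal S_{n+1}$, $\sup_{\mathbf x\in B}\|g_tu_{\mathbf f(\mathbf x)}\Gamma\|\ge e^{-\beta t}$.
   Context: A function $f:V\to\mathbb R$ is $(C,\alpha)$-good on $V$ if for every open ball $B\subset V$ and $\varepsilon>0$, $|\{\mathbf x\in B:|f(\mathbf x)|<\varepsilon\sup_B|f|\}|\le C\varepsilon^\alpha|B|$. $\mathbf f=(f_1,\dots,f_n)$ is good at $\mathbf x_0$ if there are a neighborhood $V$ of $\mathbf x_0$ and $C,\alpha>0$ such that every linear combination of $1,f_1,\dots,f_n$ is $(C,\alpha)$-good on $V$; $\mathbf f$ is good if it is good at a.e. point of $U$. $\mathbf y\in\mathbb R^n$ is VWA (very well approximable) if for some $v>n$ there are infinitely many $\mathbf q\in\mathbb Z^n$ with $|\mathbf y\mathbf q+p|\le\|\mathbf q\|^{-v}$ for some $p\in\mathbb Z$ (sup-norm); $\mathbf f$ is extremal if $\mathbf f(\mathbf x)$ is not VWA for a.e.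 $\mathbf x\in U$. With $\mathbf e_I$ the wedge of standard basis vectors $\mathbf e_i$, $i\in I\subset\{0,\dots,n\}$ (increasing order), $\|\sum_Iw_I\mathbf e_I\|=\max|w_I|$; $\mathcal S_{n+1}$ is the set of nonzero subgroups of $\mathbb Z^{n+1}$ of rank $\le n$, and for $\Gamma$ with basis $\mathbf v_1,\dots,\mathbf v_j$, $\|g\Gamma\|=\|g\mathbf v_1\wedge\dots\wedge g\mathbf v_j\|$. $u_{\mathbf y}=\begin{pmatrix}1&\mathbf y\\0&I_n\end{pmatrix}$, $g_t=\mathrm{diag}(e^t,e^{-t/n},\dots,e^{-t/n})$. *)

(* Defs.v *)
From HB Require Import structures.
From mathcomp Require Import all_boot all_order all_algebra.
From mathcomp Require Import all_classical all_reals all_analysis.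
Set Implicit Arguments. Unset Strict Implicit. Unset Printing Implicit Defensive.
Import Order.TTheory GRing.Theory Num.Theory.
Import numFieldNormedType.Exports.
Local Open Scope classical_set_scope.
Local Open Scope ring_scope.

Section Defs.
Variable R : realType.

Definition eball (d : nat) (x : 'rV[R]_d) (r : R) : set 'rV[R]_d :=
  [set y | \sum_(i < d) (y 0 i - x 0 i) ^+ 2 < r ^+ 2].

Definition obox (d : nat) (a b : 'rV[R]_d) : set 'rV[R]_d :=
  [set y | forall i, a 0 i < y 0 i < b 0 i].
Definition boxvol (d : nat) (a b : 'rV[R]_d) : R :=
  \prod_(i < d) Num.max 0 (b 0 i - a 0 i).

(** Lebesgue (outer) measure on R^d: infimum of the total volumes of
    countable covers by open boxes.  It coincides with Lebesgue measure
    on Lebesgue-measurable sets (for d >= 1). *)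
Definition leb_outer (d : nat) (A : set 'rV[R]_d) : \bar R :=
  ereal_inf [set s : \bar R | exists a b : nat -> 'rV[R]_d,
     A `<=` \bigcup_k obox (a k) (b k) /\
     s = (\sum_(0 <= k <oo) (boxvol (a k) (b k))%:E)%E].

Definition ae_in (d : nat) (U : set 'rV[R]_d) (P : 'rV[R]_d -> Prop) : Prop :=
  leb_outer [set x | U x /\ ~ P x] = 0%E.

Definition good_on (d : nat) (C alpha : R) (V : set 'rV[R]_d) (h : 'rV[R]_d -> R) : Prop :=
  forall (x : 'rV[R]_d) (r : R), 0 < r -> eball x r `<=` V ->
  forall eps : R, 0 < eps ->
    (leb_outer [set y | eball x r y /\
        ((`|h y|)%:E < eps%:E * ereal_sup [set (`|h z|)%:E | z in eball x r])%E]
     <= (C * eps `^ alpha)%:E * leb_outer (eball x r))%E.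

Definition good_at (d n : nat) (U : set 'rV[R]_d) (f : 'rV[R]_d -> 'rV[R]_n)
    (x0 : 'rV[R]_d) : Prop :=
  exists V : set 'rV[R]_d, [/\ open V, V x0 & V `<=` U] /\
  exists C alpha : R, 0 < C /\ 0 < alpha /\
    forall (c0 : R) (c : 'rV[R]_n),
      good_on C alpha V (fun x => c0 + \sum_(i < n) c 0 i * f x 0 i).

Definition good (d n : nat) (U : set 'rV[R]_d) (f : 'rV[R]_d -> 'rV[R]_n) : Prop :=
  ae_in U (good_at U f).

Definition qnorm (n : nat) (q : 'rV[int]_n) : nat := \max_(i < n) `|q ord0 i|%N.

Definition VWA (n : nat) (y : 'rV[R]_n) : Prop :=
  exists v : R, n%:R < v /\
    ~ finite_set [set q : 'rV[int]_n | exists p : int,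
        `|\sum_(i < n) y 0 i * (q 0 i)%:~R + p%:~R| <= (qnorm q)%:R `^ (- v)].

Definition extremal (d n : nat) (U : set 'rV[R]_d) (f : 'rV[R]_d -> 'rV[R]_n) : Prop :=
  ae_in U (fun x => ~ VWA (f x)).

(** Norm of the wedge v_1 /\ ... /\ v_j of the columns of M, w.r.t. the
    basis e_I (I increasing) and the max norm: max over increasing
    I : 'I_j -> 'I_N of |det of the I-rows of M|. *)
Definition wedge_norm (N j : nat) (M : 'M[R]_(N, j)) : R :=
  \big[Num.max/0]_(s : {ffun 'I_j -> 'I_N} |
        [forall k : 'I_j, forall l : 'I_j, (k < l)%N ==> (s k < s l)%N])
     `|\det (rowsub s M)|.

Definition int_span (N j : nat) (V : 'M[int]_(N, j)) : set 'cV[int]_N :=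
  [set V *m c | c in [set: 'cV[int]_j]].

Definition is_basis (N j : nat) (G : set 'cV[int]_N) (V : 'M[int]_(N, j)) : Prop :=
  \rank (map_mx (fun z : int => z%:~R : R) V) = j /\ G = int_span V.

Definition S_sub (N : nat) (G : set 'cV[int]_N) : Prop :=
  exists (j : nat) (V : 'M[int]_(N, j)), (0 < j)%N /\ (j < N)%N /\ is_basis G V.

(** ||g Gamma|| computed from a basis V of Gamma. *)
Definition gGamma_norm (N j : nat) (g : 'M[R]_N) (V : 'M[int]_(N, j)) : R :=
  wedge_norm (g *m map_mx (fun z : int => z%:~R : R) V).

Definition u_mx (n : nat) (y : 'rV[R]_n) : 'M[R]_(1 + n) :=
  block_mx 1%:M y 0 1%:M.
Definition g_mx (n : nat) (t : R) : 'M[R]_(1 + n) :=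
  block_mx (expR t)%:M 0 0 (expR (- t / n%:R))%:M.

Definition cond_star (d n : nat) (f : 'rV[R]_d -> 'rV[R]_n) (B : set 'rV[R]_d) : Prop :=
  forall beta : R, 0 < beta -> exists T : R, 0 < T /\
    forall t : R, T <= t ->
    forall G : set 'cV[int]_(1 + n), S_sub G ->
    forall (j : nat) (V : 'M[int]_(1 + n, j)), is_basis G V ->
      (ereal_sup [set (gGamma_norm (g_mx n t *m u_mx (f x)) V)%:E | x in B]
        >= (expR (- (beta * t)))%:E)%E.

End Defs.

(* Main.v *)
Require Import Defs.
From HB Require Import structures.
From mathcomp Require Import all_boot all_order all_fingroup all_algebra.
From mathcomp Require Import all_classical all_reals all_analysis.
From mathcomp Require Import ring lra zify.
Set Implicit Arguments. Unset Strict Implicit. Unset Printing Implicit Defensive.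
Import Order.TTheory GRing.Theory Num.Theory.
Import numFieldNormedType.Exports.
Local Open Scope classical_set_scope.
Local Open Scope ring_scope.

(** Both (i) => (iv) and (iii) => (ii) go through Dani's correspondence: [y] is
    VWA iff for some [gamma > 0] the lattice [g_t u_y Z^(n+1)] has a nonzero
    vector of norm at most [exp (- gamma t)] for arbitrarily large [t].

    (i) => (iv).  If (star) fails on a ball [B], then for arbitrarily large [t]
    some [Gamma] has [|g_t u_(f x) Gamma| < exp (- beta t)] for all [x] in [B];
    by a Minkowski-type bound it contains a short vector, so every [f x] with
    [x] in [B] is VWA.

    (iii) => (ii).  This is quantitative nondivergence.  A point [x] is protected
    if there is a chain of subgroups whose covolumes at [x] lie in [[eps, 1]],
    while every subgroup comparable to the whole chain has covolume at least
    [rho0]; at a protected point all nonzero vectors have norm >> eps.  Unprotected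
    points are estimated by induction on the number of available ranks: stop at
    the maximal dyadic subcubes on which some covolume is below [rho], and recurse
    there with the subgroups comparable to the one found.  Goodness implies a
    doubling property for suprema over cubes, so on a stopped cube all suprema
    are still at least [rho / K]; stopped cubes of a
    dyadic subdivision have total volume at most that of the root, so no covering
    theorem is needed.  Borel-Cantelli over integer [t] concludes.

    Instead of primitive subgroups we use integer matrices of minimal covolume
    among those with a given column space: two matrices with the same column
    space differ by an invertible real matrix, so minimality at the identity
    implies minimality under every [g]. *)

(** * Lebesgue outer measure and cubes *)

Section OuterMeasure.
Variables (R : realType) (d : nat).
Implicit Types (A B : set 'rV[R]_d) (a b c : 'rV[R]_d) (r : R).

Lemma boxvol_ge0 a b : 0 <= boxvol a b.
Proof. by apply: prodr_ge0 => i _; rewrite le_max lexx. Qed.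

Lemma leb_outer_ge0 A : (0 <= leb_outer A)%E.
Proof.
apply: le_ereal_inf_tmp => s [a [b [_ ->]]].
by apply: nneseries_ge0 => k _ _; rewrite lee_fin boxvol_ge0.
Qed.

Lemma le_leb_outer A B : A `<=` B -> (leb_outer A <= leb_outer B)%E.
Proof.
move=> AB; apply: ereal_inf_le_tmp => s [a [b [Bab ->]]].
by exists a, b; split => //; apply: subset_trans AB Bab.
Qed.

(** Each [A n] is covered up to [e / 2 ^ (n + 1)], and the doubly indexed family of boxes is
    enumerated by a bijection between [nat] and [nat * nat]. *)
Lemma leb_outer_sigma_subadditive (A : nat -> set 'rV[R]_d) :
  (leb_outer (\bigcup_n A n) <= \sum_(0 <= n <oo) leb_outer (A n))%E.
Proof.
have [[i ioo]|] := pselect (exists i, leb_outer (A i) = +oo%E).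
  rewrite (eseries_pinfty _ _ ioo) ?leey// => n _.
  by rewrite -ltNye (lt_le_trans _ (leb_outer_ge0 _)).
rewrite -forallNE => Aoo.
apply/lee_addgt0Pr => e e0.
rewrite (le_trans _ (epsilon_trick xpredT _ (ltW e0)))//; last first.
  by move=> n; exact: leb_outer_ge0.
have [G PG] : {G : nat -> (nat -> 'rV[R]_d) * (nat -> 'rV[R]_d) & forall n,
    A n `<=` \bigcup_k obox ((G n).1 k) ((G n).2 k) /\
    (\sum_(0 <= k <oo) (boxvol ((G n).1 k) ((G n).2 k))%:E <=
       leb_outer (A n) + (e / (2 ^ n.+1)%:R)%:E)%E}.
  apply: (@choice _ _ (fun n (g : (nat -> 'rV[R]_d) * (nat -> 'rV[R]_d)) =>
    A n `<=` \bigcup_k obox (g.1 k) (g.2 k) /\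
    (\sum_(0 <= k <oo) (boxvol (g.1 k) (g.2 k))%:E <=
       leb_outer (A n) + (e / (2 ^ n.+1)%:R)%:E)%E)) => n.
  have en : 0 < e / (2 ^ n.+1)%:R by rewrite divr_gt0// ltr0n expn_gt0.
  have fn : leb_outer (A n) \is a fin_num.
    by rewrite ge0_fin_numE ?leb_outer_ge0// ltey; apply/eqP/Aoo.
  have [_ [a [b [Aab ->]]] /ltW le] := lb_ereal_inf_adherent en fn.
  by exists (a, b).
pose vol (p : nat * nat) : \bar R := (boxvol ((G p.1).1 p.2) ((G p.1).2 p.2))%:E.
have vol0 p : (0 <= vol p)%E by rewrite lee_fin boxvol_ge0.
apply: (@le_trans _ _ (\esum_(p in setT) vol p)%E).
  apply: ereal_inf_lbound.
  have /card_esym/ppcard_eqP[f] := card_nat2.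
  exists (fun k => (G (f k).1).1 (f k).2), (fun k => (G (f k).1).2 (f k).2); split.
    move=> x [n _ /(PG n).1[k _ xk]].
    by exists (f^-1%FUN (n, k)) => //=; rewrite invK ?inE.
  rewrite nneseries_esum; last by move=> k _; rewrite lee_fin boxvol_ge0.
  rewrite (_ : [set _ | _] = setT); last by apply/seteqP; split.
  by apply: (reindex_esum setT setT f); exact: bij.
have -> : (\esum_(p in setT) vol p =
    \sum_(0 <= n <oo) \sum_(0 <= k <oo) vol (n, k))%E.
  have <- : setT `*`` (fun=> setT) = [set: nat * nat] by apply/seteqP; split.
  rewrite -(@esum_esum _ _ _ setT (fun=> setT) (fun n k => vol (n, k)))//.
  rewrite nneseries_esum; last by move=> n _; apply: nneseries_ge0.
  rewrite (_ : [set _ | _] = setT); last by apply/seteqP; split.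
  apply: eq_esum => n _; rewrite nneseries_esum//.
  by rewrite (_ : [set _ | _] = setT)//; apply/seteqP; split.
by apply: lee_nneseries => [n _ _|n _]; [exact: nneseries_ge0 | exact: (PG n).2].
Qed.

(** A box with equal corners has volume 0 only for [d > 0]: in dimension 0 the empty product gives
    every box volume 1. *)
Lemma leb_outer0 : (0 < d)%N -> leb_outer (set0 : set 'rV[R]_d) = 0%E.
Proof.
move=> d0; apply/eqP; rewrite eq_le leb_outer_ge0 andbT.
apply: ereal_inf_lbound; exists (fun=> 0), (fun=> 0); split; first by [].
rewrite eseries0// => k _ _; congr (_%:E).
rewrite /boxvol (bigD1 (Ordinal d0))//=.
by rewrite subrr maxxx mul0r.
Qed.

Lemma leb_outer_bigcup0 (A : nat -> set 'rV[R]_d) :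
  (forall n, leb_outer (A n) = 0%E) -> leb_outer (\bigcup_n A n) = 0%E.
Proof.
move=> A0; apply/eqP; rewrite eq_le leb_outer_ge0 andbT.
by apply: (le_trans (leb_outer_sigma_subadditive A)); rewrite eseries0.
Qed.

Lemma leb_outer_sub0 A B : A `<=` B -> leb_outer B = 0%E -> leb_outer A = 0%E.
Proof.
by move=> AB B0; apply/eqP; rewrite eq_le leb_outer_ge0 andbT -B0 le_leb_outer.
Qed.

Lemma leb_outerU A B : (0 < d)%N ->
  (leb_outer (A `|` B) <= leb_outer A + leb_outer B)%E.
Proof.
move=> d0; rewrite -bigcup2E.
apply: (le_trans (leb_outer_sigma_subadditive _)).
rewrite (nneseries_split 0 2)//; last by move=> k _; exact: leb_outer_ge0.
rewrite add0n big_nat_recr//= big_nat1/= eseries0 ?adde0// => k.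
by rewrite /bigcup2; case: k => [|[|k]]//= _ _; rewrite leb_outer0.
Qed.

Lemma leb_outer_bigcup_seq (T : eqType) (s : seq T) (A : T -> set 'rV[R]_d) :
  (0 < d)%N ->
  (leb_outer [set x | exists2 i, i \in s & A i x] <= \sum_(i <- s) leb_outer (A i))%E.
Proof.
move=> d0; elim: s => [|i s IH].
  rewrite big_nil (_ : [set x | _] = set0) ?leb_outer0//.
  by apply/seteqP; split => // x [].
rewrite big_cons; apply: le_trans (leeD (lexx _) IH).
apply: le_trans (leb_outerU _ _ d0); apply: le_leb_outer => x [k].
by rewrite inE => /orP[/eqP->|ks] Ak; [left|right; exists k].
Qed.

(** Closed, so that the dyadic children cover their parent and nested sequences have a common
    point. *)
Definition cube c r : set 'rV[R]_d := [set y | forall i, `|y 0 i - c 0 i| <= r].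

Lemma cube_center c r : 0 <= r -> cube c r c.
Proof. by move=> r0 i; rewrite subrr normr0. Qed.

Lemma leb_outer_cube_le c r : (0 < d)%N -> 0 < r ->
  (leb_outer (cube c r) <= ((4 * r) ^+ d)%:E)%E.
Proof.
move=> d0 r0; apply: ereal_inf_lbound.
(* One open box of twice the side contains the closed cube; all other boxes are degenerate. *)
exists (fun k => if k == 0%N then c - const_mx (2 * r) else 0),
  (fun k => if k == 0%N then c + const_mx (2 * r) else 0); split.
  move=> x xc; exists 0%N => // i; rewrite /= !mxE.
  by have := xc i; rewrite ler_norml => /andP[]; lra.
rewrite (nneseries_split 0 1)//; last by move=> k _; rewrite lee_fin boxvol_ge0.
rewrite add0n big_nat1/= eseries0 ?adde0.
  congr (_%:E); rewrite /boxvol (eq_bigr (fun=> 4 * r)).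
    by rewrite prodr_const card_ord.
  by move=> i _; rewrite !mxE; rewrite max_r; lra.
move=> [|k]//= _ _; congr (_%:E).
by rewrite /boxvol (bigD1 (Ordinal d0))//= subrr maxxx mul0r.
Qed.

(** Sign patterns index the [2 ^ d] dyadic subcubes; [true] selects the lower half of a
    coordinate. *)
Definition child c r (s : {ffun 'I_d -> bool}) : 'rV[R]_d :=
  \row_i (c 0 i + (-1) ^+ s i * (r / 2)).

Lemma child_sub c r s : 0 <= r -> cube (child c r s) (r / 2) `<=` cube c r.
Proof.
move=> r0 x xs i; have := xs i; rewrite !mxE.
by case: (s i); rewrite ?expr1 ?expr0 !ler_norml; lra.
Qed.

Lemma child_cover c r x : cube c r x -> exists s, cube (child c r s) (r / 2) x.
Proof.
move=> xc; exists [ffun i => x 0 i < c 0 i] => i; have := xc i.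
rewrite !mxE ffunE; case: ltP; rewrite ?expr1 ?expr0 !ler_norml; lra.
Qed.

End OuterMeasure.

(** * Sharp lower bound for the outer measure of a cube *)

Section CubeLowerBound.
Variables (R : realType) (d : nat).
Implicit Types (a b c x : 'rV[R]_d) (r : R).

(** Length of the overlap of two intervals; accordingly [ivol] is the volume of the part of a box
    inside a cube. *)
Definition ilen (a b u v : R) : R := Num.max 0 (Num.min b v - Num.max a u).

Definition ivol a b c r : R :=
  \prod_i ilen (a 0 i) (b 0 i) (c 0 i - r) (c 0 i + r).

Lemma ilen_split (a b c r : R) : 0 <= r ->
  ilen a b (c - r) (c + r) =
  \sum_(s : bool) ilen a b (c + (-1) ^+ s * (r / 2) - r / 2)
                           (c + (-1) ^+ s * (r / 2) + r / 2).
Proof.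
move=> r0; rewrite big_bool/= expr1 expr0 /ilen.
have -> : c + -1 * (r / 2) - r / 2 = c - r by lra.
have -> : c + -1 * (r / 2) + r / 2 = c by lra.
have -> : c + 1 * (r / 2) - r / 2 = c by lra.
have -> : c + 1 * (r / 2) + r / 2 = c + r by lra.
case: (leP a (c - r)) => ?; case: (leP a c) => ?; case: (leP b c) => ?;
  case: (leP b (c + r)) => ?; do 3?case: leP => ?; lra.
Qed.

Lemma ivol_ge0 a b c r : 0 <= ivol a b c r.
Proof. by apply: prodr_ge0 => i _; rewrite le_max lexx. Qed.

Lemma ivol_le_boxvol a b c r : ivol a b c r <= boxvol a b.
Proof.
apply: ler_prod => i _; rewrite le_max lexx/= /ilen ge_max le_max lexx/=.
rewrite le_max; apply/orP; right; apply: lerB.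
  by rewrite ge_min lexx.
by rewrite le_max lexx.
Qed.

(** Each overlap length splits at the midpoint, and expanding the product over coordinates yields
    one term per sign pattern. *)
Lemma ivol_children a b c r : 0 <= r ->
  ivol a b c r = \sum_(s : {ffun 'I_d -> bool}) ivol a b (child c r s) (r / 2).
Proof.
move=> r0; rewrite /ivol; under eq_bigr do rewrite ilen_split//.
by rewrite bigA_distr_bigA; apply: eq_bigr => s _; apply: eq_bigr => i _; rewrite !mxE.
Qed.

Lemma ivol_inside a b c r : 0 <= r ->
  (forall i, a 0 i <= c 0 i - r /\ c 0 i + r <= b 0 i) -> ivol a b c r = (2 * r) ^+ d.
Proof.
move=> r0 ab; rewrite /ivol (eq_bigr (fun=> 2 * r)) ?prodr_const ?card_ord// => i _.
have [? ?] := ab i; rewrite /ilen min_r// max_r// max_r; lra.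
Qed.

Lemma ge_half_pow (r e : R) : 0 < e -> exists n, r / 2 ^+ n < e.
Proof.
move=> e0; exists (Num.bound (r / e)).
rewrite ltr_pdivrMr ?exprn_gt0// mulrC -ltr_pdivrMr//.
exact: upper_nthrootP.
Qed.

(** Coordinatewise, the common point is the supremum of the lower endpoints. *)
Lemma nested_cubes (c : nat -> 'rV[R]_d) r : 0 <= r ->
  (forall n, cube (c n.+1) (r / 2 ^+ n.+1) `<=` cube (c n) (r / 2 ^+ n)) ->
  exists x, forall n, cube (c n) (r / 2 ^+ n) x.
Proof.
move=> r0 sub.
have rn n : 0 <= r / 2 ^+ n by rewrite divr_ge0// exprn_ge0.
have subm m n : (m <= n)%N -> cube (c n) (r / 2 ^+ n) `<=` cube (c m) (r / 2 ^+ m).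
  elim: n => [|n IH]; first by rewrite leqn0 => /eqP->.
  rewrite leq_eqVlt => /orP[/eqP->//|]; rewrite ltnS => /IH; exact: subset_trans.
pose lo i n := c n 0 i - r / 2 ^+ n.
have lohi i m n : lo i m <= c n 0 i + r / 2 ^+ n.
  pose k := maxn m n.
  have km := subm _ _ (leq_maxl m n) _ (cube_center (c k) (rn k)) i.
  have kn := subm _ _ (leq_maxr m n) _ (cube_center (c k) (rn k)) i.
  by move: km kn; rewrite /lo !ler_norml; lra.
have hs i : has_sup [set lo i n | n in setT].
  split; first by exists (lo i 0%N), 0%N.
  by exists (c 0%N 0 i + r / 2 ^+ 0) => _ [n _ <-].
exists (\row_i sup [set lo i n | n in setT]) => n i; rewrite mxE ler_norml.
apply/andP; split.
  have : lo i n <= sup [set lo i n | n in setT] by apply: sup_upper_bound; [exact: hs|exists n].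
  by rewrite {1}/lo; lra.
have : sup [set lo i n | n in setT] <= c n 0 i + r / 2 ^+ n.
  by apply: ge_sup; [exact: (hs i).1 | move=> _ [m _ <-]].
lra.
Qed.

(* If a cover had too small a total volume, bisection would give nested cubes
   on each of which it still does; but an open box of the cover around their common
   point eventually contains the whole cube. *)
Lemma leb_outer_cube_ge c r : 0 < r -> (((2 * r) ^+ d)%:E <= leb_outer (cube c r))%E.
Proof.
move=> r0; apply: le_ereal_inf_tmp => _ [a [b [cov ->]]].
rewrite leNgt; apply/negP => lt.
pose V (p : 'rV[R]_d * R) : \bar R := (\sum_(0 <= k <oo) (ivol (a k) (b k) p.1 p.2)%:E)%E.
have V0 k p : (0 <= (ivol (a k) (b k) p.1 p.2)%:E)%E by rewrite lee_fin ivol_ge0.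
have Vc : (V (c, r) < ((2 * r) ^+ d)%:E)%E.
  apply: le_lt_trans lt; apply: lee_nneseries => k; first by rewrite V0.
  by rewrite lee_fin ivol_le_boxvol.
(* Some child inherits the deficit, as otherwise summing over the children would contradict
   additivity. The conditions on [p] stay inside the existential so that choice yields a total
   function. *)
have step (p : 'rV[R]_d * R) : exists s, (0 < p.2)%R -> (V p < ((2 * p.2) ^+ d)%:E)%E ->
    (V (child p.1 p.2 s, (p.2 / 2)%R) < ((2 * (p.2 / 2)) ^+ d)%:E)%E.
  apply: contrapT => /forallNP H.
  have [p0 Vp] : (0 < p.2)%R /\ (V p < ((2 * p.2) ^+ d)%:E)%E.
    by have := H [ffun=> true]; case/not_implyP => ? /not_implyP[].
  move: Vp; rewrite ltNge => /negP; apply.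
  have -> : V p = (\sum_(s : {ffun 'I_d -> bool}) V (child p.1 p.2 s, (p.2 / 2)%R))%E.
    rewrite /V -nneseries_sum; last by move=> s k _; rewrite lee_fin ivol_ge0.
    by apply: eq_eseriesr => k _; rewrite sumEFin -ivol_children// ltW.
  apply: (@le_trans _ _ (\sum_(s : {ffun 'I_d -> bool}) ((2 * (p.2 / 2)) ^+ d)%:E)%E).
    rewrite sumEFin lee_fin sumr_const card_ffun card_bool card_ord -[leRHS]mulr_natl natrX -exprMn.
    by rewrite (_ : 2 * (2 * (p.2 / 2)) = 2 * p.2)//; lra.
  apply: lee_sum => s _; rewrite leNgt; apply/negP => Vs.
  by apply: (H s).
have [g gP] := choice step.
pose q n : 'rV[R]_d * R := iter n (fun p => (child p.1 p.2 (g p), p.2 / 2)) (c, r).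
have q2 n : (q n).2 = r / 2 ^+ n.
  elim: n => [|n IH]; first by rewrite expr0 divr1.
  by rewrite /q iterS -/(q n)/= IH exprS invfM mulrA mulrAC.
have qpos n : 0 < (q n).2 by rewrite q2 divr_gt0// exprn_gt0.
have Vq n : (V (q n) < ((2 * (q n).2) ^+ d)%:E)%E.
  by elim: n => [//|n IH]; rewrite /q iterS -/(q n)/=; apply: gP.
have [x xq] : exists x, forall n, cube (q n).1 (r / 2 ^+ n) x.
  apply: nested_cubes; first exact: ltW.
  by move=> n; rewrite -!q2 /q iterS -/(q n)/=; apply: child_sub; apply: ltW.
have [k _ xk] : (\bigcup_k obox (a k) (b k)) x.
  by apply: cov; have := xq 0%N; rewrite expr0 divr1.
have /choice[N NP] : forall i, exists n, r / 2 ^+ n < Num.min (x 0 i - a k 0 i) (b k 0 i - x 0 i) / 2.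
  move=> i; apply: ge_half_pow; rewrite divr_gt0// lt_min !subr_gt0.
  by have /andP[-> ->] := xk i.
(* At this level the whole cube lies in the [k]-th box, so that single term of the series is already
   its full volume. *)
pose n := \max_i N i.
have := Vq n; rewrite ltNge => /negP; apply.
apply: le_trans (nneseries_lim_ge k.+1 _); last by move=> j _ _; rewrite V0.
rewrite big_nat_recr//= -[leLHS]add0e; apply: leeD; first by apply: sume_ge0 => j _; rewrite V0.
rewrite lee_fin ivol_inside//; first exact: ltW.
move=> i; have := xq n i; rewrite -q2.
have : (q n).2 < Num.min (x 0 i - a k 0 i) (b k 0 i - x 0 i) / 2.
  rewrite q2; apply: le_lt_trans (NP i); rewrite ler_pM2l// lef_pV2 ?posrE ?exprn_gt0//.
  by rewrite ler_weXn2l ?ler1n// leq_bigmax.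
by rewrite ler_norml ltr_pdivlMr// lt_min => /andP[]; lra.
Qed.
End CubeLowerBound.

Lemma nneseries_le_bound (R : realType) (a : nat -> \bar R) (M : \bar R) :
  (forall n, 0 <= a n)%E -> (forall n, \sum_(0 <= k < n) a k <= M)%E ->
  (\sum_(0 <= k <oo) a k <= M)%E.
Proof.
move=> a0 aM; apply: lime_le; first by apply: is_cvg_nneseries => n _ _; apply: a0.
by near=> n; apply: aM.
Unshelve. all: by end_near.
Qed.

(** * Stopping times on dyadic cubes *)

Section Stopping.
Variables (R : realType) (d : nat).
Hypothesis d0 : (0 < d)%N.
Variables (A : set 'rV[R]_d) (stop : 'rV[R]_d -> R -> Prop) (c : 'rV[R]_d) (r kap : R).
Hypotheses (r0 : 0 < r) (kap0 : 0 <= kap) (root : ~ stop c r).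
(** Only maximal stopped cubes need a bound: [c1] is unstopped and [c2] is a half-size subcube of
    it. *)
Hypothesis stop_bound : forall c1 r1, 0 < r1 -> cube c1 r1 `<=` cube c r -> ~ stop c1 r1 ->
  forall c2, cube c2 (r1 / 2) `<=` cube c1 r1 -> stop c2 (r1 / 2) ->
  (leb_outer (A `&` cube c2 (r1 / 2)) <= (kap * (r1 / 2) ^+ d)%:E)%E.
Hypothesis stop_small : forall x, A x -> cube c r x -> exists2 del, 0 < del &
  forall c1 r1, 0 < r1 < del -> cube c1 r1 `<=` cube c r -> cube c1 r1 x -> stop c1 r1.

Let rad n : R := r / 2 ^+ n.

Let rad_gt0 n : 0 < rad n. Proof. by rewrite divr_gt0// exprn_gt0. Qed.

Let radS n : rad n.+1 = rad n / 2. Proof. by rewrite /rad exprS invfM mulrA mulrAC. Qed.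

Let children (c1 : 'rV[R]_d) (r1 : R) := [seq child c1 r1 s | s <- enum {ffun 'I_d -> bool}].

Let next (U : seq 'rV[R]_d) n := flatten [seq children c1 (rad n) | c1 <- U].

(** Centres of the level [n] dyadic cubes that are not stopped and have no stopped ancestor; a list,
    so that volumes reduce to counting. *)
Fixpoint unstopped n : seq 'rV[R]_d :=
  if n is m.+1 then [seq c1 <- next (unstopped m) m | ~~ `[< stop c1 (rad m.+1) >]]
  else [:: c].

Let stopped n := [seq c1 <- next (unstopped n) n | `[< stop c1 (rad n.+1) >]].

Let size_next U n : size (next U n) = (2 ^ d * size U)%N.
Proof.
elim: U => [|c1 U IH] /=; first by rewrite muln0.
by rewrite /next/= size_cat IH size_map -cardE card_ffun card_bool card_ord mulnS.
Qed.

Let size_stopped n : (size (stopped n) + size (unstopped n.+1) = 2 ^ d * size (unstopped n))%N.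
Proof. by rewrite -(size_next _ n) !size_filter/= count_predC. Qed.

Let nextP U n c2 : c2 \in next U n -> exists2 c1, c1 \in U &
  cube c2 (rad n.+1) `<=` cube c1 (rad n).
Proof.
move=> /flatten_mapP[c1 c1U /mapP[s _ ->]]; exists c1 => //.
by rewrite radS; apply: child_sub; apply: ltW.
Qed.

Let unstoppedP n c1 : c1 \in unstopped n ->
  cube c1 (rad n) `<=` cube c r /\ ~ stop c1 (rad n).
Proof.
elim: n c1 => [|n IH] c1 /=.
  by rewrite inE => /eqP->; rewrite /rad expr0 divr1; split.
rewrite mem_filter => /andP[/asboolP ns /nextP[c2 /IH[sub _] sub2]].
by split=> //; apply: subset_trans sub2 sub.
Qed.

(* The volume stopped at level [n + 1] telescopes as [mass n - mass n.+1]. *)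
Let mass n : R := (size (unstopped n))%:R * rad n ^+ d.

Let mass_stopped n : (size (stopped n))%:R * rad n.+1 ^+ d = mass n - mass n.+1.
Proof.
apply/eqP; rewrite eq_sym subr_eq -mulrDl -natrD size_stopped natrM natrX; apply/eqP.
have -> : mass n = (size (unstopped n))%:R * (rad n.+1 * 2) ^+ d by rewrite radS divfK.
by rewrite exprMn mulrCA [RHS]mulrC [in RHS](mulrC (2 ^+ d)).
Qed.

(** Points of [A] cannot remain unstopped at all levels, so the stopped cubes cover them; the bounds
    on these cubes sum to [kap] times the stopped mass, which telescopes. *)
Lemma stopping_time_bound : (leb_outer (A `&` cube c r) <= (kap * r ^+ d)%:E)%E.
Proof.
pose E n := [set x | exists2 c1, c1 \in stopped n & (A `&` cube c1 (rad n.+1)) x].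
have cov : A `&` cube c r `<=` \bigcup_n E n.
  move=> x [Ax xc]; apply: contrapT => nE.
  have H n : exists2 c1, c1 \in unstopped n & cube c1 (rad n) x.
    elim: n => [|n [c1 c1U xc1]].
      by exists c; rewrite ?inE// /rad expr0 divr1.
    have [s xs] := child_cover xc1; rewrite -radS in xs.
    have sn : child c1 (rad n) s \in next (unstopped n) n.
      by apply/flatten_mapP; exists c1 => //; apply: map_f; rewrite mem_enum.
    exists (child c1 (rad n) s) => //=; rewrite mem_filter sn andbT.
    apply/asboolPn => st; apply: nE; exists n => //; exists (child c1 (rad n) s) => //.
    by rewrite mem_filter sn andbT; apply/asboolP.
  have [del del0 small] := stop_small Ax xc.
  have [n rn] := ge_half_pow r del0.
  have [c1 /unstoppedP[sub ns] xc1] := H n.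
  by apply: ns; apply: small => //; apply/andP; split.
apply: (le_trans (le_leb_outer cov)).
apply: (le_trans (leb_outer_sigma_subadditive _)).
have EB n : (leb_outer (E n) <= (kap * (mass n - mass n.+1))%:E)%E.
  apply: (le_trans (leb_outer_bigcup_seq _ (fun c1 => A `&` cube c1 (rad n.+1)) d0)).
  apply: (@le_trans _ _ (\sum_(c1 <- stopped n) (kap * rad n.+1 ^+ d)%:E)%E).
    rewrite big_seq [leRHS]big_seq; apply: lee_sum => c2.
    rewrite mem_filter => /andP[/asboolP st /nextP[c1 /unstoppedP[sub ns] sub2]].
    by move: st sub2; rewrite radS => st sub2; apply: (stop_bound _ sub).
  by rewrite -mass_stopped sumEFin lee_fin big_const_seq count_predT iter_addr_0 mulr_natl -mulrnAr.
apply: nneseries_le_bound => [n|n]; first exact: leb_outer_ge0.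
apply: (@le_trans _ _ (kap * (mass 0 - mass n))%:E%E).
  elim: n => [|n IH]; first by rewrite big_geq// subrr mulr0.
  rewrite big_nat_recr//=; apply: le_trans (leeD IH (EB n)) _.
  by rewrite -EFinD lee_fin -mulrDr addrA subrK.
rewrite lee_fin ler_wpM2l// /mass /rad expr0 divr1 mul1r.
by rewrite lerBlDr lerDl mulr_ge0 ?ler0n// exprn_ge0//; apply: ltW (rad_gt0 n).
Qed.

End Stopping.

(** * Good functions and quantitative nondivergence *)

Lemma eball_sub_cube (R : realType) (d : nat) (c : 'rV[R]_d) q : 0 <= q ->
  eball c q `<=` cube c q.
Proof.
move=> q0 y yb i; rewrite -ler_sqr ?nnegrE// real_normK ?num_real//.
apply: ltW; apply: le_lt_trans yb; rewrite (bigD1 i)//= lerDl.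
by apply: sumr_ge0 => k _; apply: sqr_ge0.
Qed.

(** The radius [2 * d * r] is a crude substitute for [sqrt d * r] that leaves room for the strict
    inequality. *)
Lemma cube_sub_eball (R : realType) (d : nat) (c : 'rV[R]_d) r : (0 < d)%N -> 0 < r ->
  cube c r `<=` eball c (2 * d%:R * r).
Proof.
move=> d0 r0 y yc; have d1 : 1 <= d%:R :> R by rewrite ler1n.
apply: (@le_lt_trans _ _ (\sum_(i < d) r ^+ 2)).
  apply: ler_sum => i _; rewrite -[leLHS]real_normK ?num_real// ler_sqr ?nnegrE ?(ltW r0)//.
rewrite sumr_const card_ord -[ltLHS]mulr_natl !exprMn.
rewrite ltr_pM2r ?exprn_gt0//; nra.
Qed.

(** Goodness speaks of Euclidean balls: the cube is enclosed in a ball and that ball in a larger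
    cube, at the cost of [(8 * d) ^ d]. The supremum over the ball is at least [rho], so [eps] is at
    most [eps / rho] times it. *)
Lemma good_on_cube (R : realType) (d : nat) (C al : R) (V : set 'rV[R]_d) h c r rho eps :
  (0 < d)%N -> 0 < C -> good_on C al V h -> 0 < r -> cube c (2 * d%:R * r) `<=` V ->
  0 < rho -> 0 < eps -> (exists2 y, cube c r y & rho <= `|h y|) ->
  (leb_outer [set y | cube c r y /\ (`|h y| < eps)%R] <=
     (C * (8 * d%:R) ^+ d * (eps / rho) `^ al * r ^+ d)%:E)%E.
Proof.
move=> d0 C0 hg r0 cV rho0 eps0 [y0 y0c rhoy0].
have d1 : 1 <= d%:R :> R by rewrite ler1n.
pose q : R := 2 * d%:R * r.
have q0 : 0 < q by rewrite !mulr_gt0// ltr0n.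
have ball_cube := @eball_sub_cube R d c q (ltW q0).
have cube_ball : cube c r `<=` eball c q by exact: cube_sub_eball.
have dq : ((4 * q) ^+ d = (8 * d%:R) ^+ d * r ^+ d)%R by rewrite -exprMn /q; congr (_ ^+ _); ring.
have er0 : 0 < eps / rho by rewrite divr_gt0.
have := hg c q q0 (subset_trans ball_cube cV) _ er0.
set E := [set y | eball c q y /\ _]; move=> gE.
apply: (@le_trans _ _ (leb_outer E)).
  apply: le_leb_outer => y [yc hy]; split; first exact: cube_ball.
  apply: (@lt_le_trans _ _ (eps%:E)); first by rewrite lte_fin.
  have -> : eps%:E = ((eps / rho)%:E * rho%:E)%E by rewrite -EFinM divfK// gt_eqF.
  rewrite lee_pmul2l// ?lte_fin//.
  apply: (@le_trans _ _ (`|h y0|%:E)); first by rewrite lee_fin.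
  by apply: ereal_sup_ubound; exists y0 => //; apply: cube_ball.
apply: (le_trans gE).
have -> : (C * (8 * d%:R) ^+ d * (eps / rho) `^ al * r ^+ d)%R =
    (C * (eps / rho) `^ al * (4 * q) ^+ d)%R by rewrite dq; ring.
rewrite [leRHS]EFinM; apply: lee_wpmul2l; first by rewrite lee_fin mulr_ge0 ?powR_ge0// ltW.
exact: le_trans (le_leb_outer ball_cube) (leb_outer_cube_le c d0 q0).
Qed.

Section Nondivergence.
Variables (R : realType) (d : nat) (C al : R) (V : set 'rV[R]_d).
Variables (I : Type) (psi : I -> 'rV[R]_d -> R) (rk : I -> nat) (cmp : I -> I -> Prop).
Variables (c0 : 'rV[R]_d) (r0 : R).
Hypotheses (d0 : (0 < d)%N) (C0 : 0 < C) (al0 : 0 < al).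
(** [psi s] will be a maximum of good functions; for sublevel estimates it suffices that some good
    [h] has [|h|] below [psi s] and equal to it at a given point. *)
Hypothesis psi_good : forall s y, exists h, [/\ good_on C al V h, `|h y| = psi s y &
  forall z, `|h z| <= psi s z].
Hypothesis psi_usc : forall s x rho, cube c0 r0 x -> psi s x < rho ->
  exists2 del, 0 < del & forall y, cube x del y -> psi s y < rho.
Hypothesis cmp_sym : forall s s', cmp s s' -> cmp s' s.
Hypothesis cmp_rk : forall s s', cmp s s' -> rk s != rk s'.
Hypothesis rootV : cube c0 ((2 * d%:R + 1) * r0) `<=` V.

Definition dimconst : R := C * (8 * d%:R) ^+ d.
(** Chosen so that [dimconst * dblconst ^ (- al) = dimconst / (dimconst + 1) < 1], which is what
    doubling uses. *)
Definition dblconst : R := (dimconst + 1) `^ al^-1.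

Lemma dimconst_ge0 : 0 <= dimconst.
Proof. by rewrite mulr_ge0 ?exprn_ge0 ?mulr_ge0// ltW. Qed.

Lemma cube_rad_le (c1 c2 : 'rV[R]_d) (r1 r2 : R) : 0 <= r1 ->
  cube c1 r1 `<=` cube c2 r2 -> r1 <= r2.
Proof.
move=> r10 sub; pose i := Ordinal d0.
have h1 : cube c2 r2 (c1 + const_mx r1).
  by apply: sub => k; rewrite !mxE addrAC subrr add0r ger0_norm.
have h2 : cube c2 r2 (c1 - const_mx r1).
  by apply: sub => k; rewrite !mxE addrAC subrr add0r normrN ger0_norm.
by have := h1 i; have := h2 i; rewrite !mxE !ler_norml; lra.
Qed.

(** The centre is within [r0] of [c0] and the dilation adds at most [2 * d * r0]; this accounts for
    the factor in [rootV]. *)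
Lemma dilated_cube_sub c r : 0 < r -> cube c r `<=` cube c0 r0 ->
  cube c (2 * d%:R * r) `<=` V.
Proof.
move=> rp sub; apply: subset_trans rootV => y yc i.
have rr0 := cube_rad_le (ltW rp) sub.
have := sub c (cube_center c (ltW rp)) i; have := yc i.
have : d%:R * r <= d%:R * r0 by rewrite ler_wpM2l.
by rewrite !ler_norml; nra.
Qed.

Lemma psi_good_cube s c r rho eps : 0 < r -> cube c r `<=` cube c0 r0 ->
  0 < rho -> 0 < eps -> (exists2 y, cube c r y & rho <= psi s y) ->
  (leb_outer [set y | cube c r y /\ (psi s y < eps)%R] <=
     (dimconst * (eps / rho) `^ al * r ^+ d)%:E)%E.
Proof.
move=> rp sub rho0 eps0 [y yc]; have [h [hg <- hle]] := psi_good s y => rhoy.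
apply: le_trans (good_on_cube d0 C0 hg rp (dilated_cube_sub rp sub) rho0 eps0 _).
  by apply: le_leb_outer => z [zc]; split=> //; apply: le_lt_trans (hle z) _.
by exists y.
Qed.

Lemma dblconst_ge1 : 1 <= dblconst.
Proof.
have -> : 1 = 1 `^ al^-1 :> R by rewrite powR1.
by apply: ge0_ler_powR; rewrite ?nnegrE ?invr_ge0 ?(ltW al0)// ?lerDr ?addr_ge0 ?dimconst_ge0.
Qed.

(* Otherwise the half-size cube lies in a sublevel set too small to contain it. *)
Lemma psi_doubling s c r c' rho : 0 < r -> cube c r `<=` cube c0 r0 ->
  cube c' (r / 2) `<=` cube c r -> 0 < rho -> (exists2 y, cube c r y & rho <= psi s y) ->
  exists2 y, cube c' (r / 2) y & rho / dblconst <= psi s y.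
Proof.
move=> rp sub sub' rho0 ex.
have K0 : 0 < dblconst by apply: lt_le_trans dblconst_ge1.
apply: contrapT => /forall2NP H.
have e0 : 0 < rho / dblconst by rewrite divr_gt0.
have := psi_good_cube rp sub rho0 e0 ex.
have r2 : 0 < r / 2 by rewrite divr_gt0.
have lo : ((r ^+ d)%:E <= leb_outer [set y | cube c r y /\ (psi s y < rho / dblconst)%R])%E.
  have := leb_outer_cube_ge c' r2; rewrite mulrC divfK// => /le_trans; apply.
  apply: le_leb_outer => y yc; split; first exact: sub'.
  by have [//|/negP] := H y; rewrite -ltNge.
move=> /(le_trans lo); rewrite lee_fin.
have -> : rho / dblconst / rho = dblconst^-1 by rewrite mulrAC divff ?mul1r// gt_eqF.
have -> : dblconst^-1 `^ al = (dimconst + 1)^-1.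
  rewrite -powR_inv1 ?(ltW K0)// powRAC powR_inv1 ?powR_ge0//.
  by rewrite /dblconst -powRrM mulVf ?gt_eqF// powRr1// addr_ge0// dimconst_ge0.
by rewrite ler_pMl ?exprn_gt0// ler_pdivlMr; have := dimconst_ge0; lra.
Qed.

Variables (eps rho0 : R).
Hypotheses (eps0 : 0 < eps) (rho00 : 0 < rho0).

(** Relative to [S], the family still available in the recursion. The chain [F] may be empty, and
    then all of [S] must be at least [rho0] at [x]. *)
Definition protected (S : set I) (x : 'rV[R]_d) : Prop := exists F : set I,
  [/\ forall s, F s -> S s /\ eps <= psi s x <= 1,
      forall s s', F s -> F s' -> s = s' \/ cmp s s' &
      forall s, S s -> (forall s', F s' -> cmp s' s) -> rho0 <= psi s x].

(** Induction on the number of ranks left in [L]. Each level costs one factor [dblconst] in the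
    lower bound for suprema and one term [dimconst * (eps / rho0) ^ al] in measure. *)
Lemma quantitative_nondivergence m (S : set I) c r (L : seq nat) :
  0 < r -> cube c r `<=` cube c0 r0 -> (size L <= m)%N -> (forall s, S s -> rk s \in L) ->
  dblconst ^+ m * rho0 <= 1 ->
  (forall s, S s -> exists2 y, cube c r y & dblconst ^+ m * rho0 <= psi s y) ->
  (leb_outer [set x | cube c r x /\ ~ protected S x] <=
     (m%:R * (dimconst * (eps / rho0) `^ al) * r ^+ d)%:E)%E.
Proof.
elim: m => [|m IH] in S c r L *.
  rewrite leqn0 size_eq0 => rp sub /eqP-> SL _ _.
  rewrite (_ : [set x | _] = set0) ?leb_outer0 ?mul0r//.
  apply/seteqP; split=> // x [_]; apply; exists set0.
  by split=> // s /SL.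
move=> rp sub sL SL K1 SK.
have K0 : 0 < dblconst by apply: lt_le_trans dblconst_ge1.
pose rho := dblconst ^+ m.+1 * rho0.
have rhop : 0 < rho by rewrite mulr_gt0 ?exprn_gt0.
pose stop (c1 : 'rV[R]_d) (r1 : R) := exists2 s, S s & forall y, cube c1 r1 y -> psi s y < rho.
have nstop c1 r1 s : ~ stop c1 r1 -> S s -> exists2 y, cube c1 r1 y & rho <= psi s y.
  move=> ns Ss; apply: contrapT => /forall2NP H; apply: ns; exists s => // y yc.
  by have [//|/negP] := H y; rewrite -ltNge.
pose A := [set x | ~ protected S x].
have -> : [set x | cube c r x /\ ~ protected S x] = A `&` cube c r.
  by apply/seteqP; split=> x [].
have kap0 : 0 <= dimconst * (eps / rho0) `^ al by rewrite mulr_ge0 ?powR_ge0 ?dimconst_ge0.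
apply: (stopping_time_bound d0 (stop := stop)) => //.
- by rewrite mulr_ge0.
- by move=> [s /SK[y yc rhoy] /(_ y yc)]; rewrite ltNge rhoy.
- move=> c1 r1 r1p sub1 ns c2 sub2 [s Ss slt].
  have r2p : 0 < r1 / 2 by rewrite divr_gt0.
  have sub20 : cube c2 (r1 / 2) `<=` cube c0 r0.
    by apply: subset_trans sub2 (subset_trans sub1 sub).
  have dbl s' : S s' -> exists2 y, cube c2 (r1 / 2) y & dblconst ^+ m * rho0 <= psi s' y.
    move=> /(nstop _ _ _ ns) /(psi_doubling r1p (subset_trans sub1 sub) sub2 rhop).
    have -> // : rho / dblconst = dblconst ^+ m * rho0.
    by rewrite /rho exprS; field; rewrite gt_eqF.
  have Km : 1 <= dblconst ^+ m by rewrite exprn_ege1// dblconst_ge1.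
  (* On a stopped cube, either [psi s] is below [eps], or adding [s] to a chain protecting [x] among
     the indices comparable to [s] protects [x] in [S]. *)
  apply: (@le_trans _ _ (leb_outer ([set y | cube c2 (r1 / 2) y /\ (psi s y < eps)%R] `|`
     [set x | cube c2 (r1 / 2) x /\ ~ protected (S `&` cmp s) x]))).
    apply: le_leb_outer => x [nP xc].
    have [lt|ge] := ltP (psi s x) eps; [by left|right; split=> // -[F [F1 F2 F3]]].
    apply: nP; exists (F `|` [set s]); split.
    + move=> s' [/F1[[Ss' _] ?]//|->]; split=> //; rewrite ge/=.
      by apply: ltW; apply: lt_le_trans (slt x xc) _.
    + move=> s1 s2 [F1s|->] [F2s|->]; [exact: F2| | |by left]; right.
        by apply: cmp_sym; have [[]] := F1 _ F1s.
      by have [[]] := F1 _ F2s.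
    + move=> s' Ss' Hs'; apply: F3; last by move=> s'' Fs''; apply: Hs'; left.
      by split=> //; apply: Hs'; right.
  apply: (le_trans (leb_outerU _ _ d0)).
  rewrite -[m.+1%:R]natr1 2!mulrDl mul1r [(m%:R * _ * _ + _)%R]addrC EFinD; apply: leeD.
    apply: psi_good_cube => //; have [y yc le] := dbl s Ss; exists y => //.
    by apply: le_trans le; rewrite ler_peMl// ltW.
  (* Indices comparable to [s] have ranks other than [rk s], so this rank leaves the list. *)
  apply: (IH _ _ _ [seq k <- L | k != rk s]) => //.
  + rewrite size_filter -ltnS; apply: leq_trans sL.
    have := count_predC (pred1 (rk s)) L; have := SL s Ss.
    by rewrite -has_pred1 has_count => ? <-; rewrite -addn1 addnC leq_add2r.
  + by move=> s' [Ss' ss']; rewrite mem_filter SL// andbT eq_sym cmp_rk.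
  + apply: le_trans K1; rewrite ler_pM2r// exprS ler_peMl ?dblconst_ge1//.
    exact: le_trans Km.
  + by move=> s' [Ss' _]; apply: dbl.
- move=> x nP xc.
  (* Otherwise the empty chain would protect [x]. *)
  have [s Ss sx] : exists2 s, S s & psi s x < rho0.
    apply: contrapT => /forall2NP H; apply: nP; exists set0; split=> // s Ss _.
    by have [//|/negP] := H s; rewrite -leNgt.
  have sx' : psi s x < rho.
    apply: lt_le_trans sx _; rewrite ler_peMl ?exprn_ege1 ?dblconst_ge1//; exact: ltW.
  have [del del0 H] := psi_usc (sub x xc) sx'.
  (* Two points of a cube of half-side [r1] differ by at most [2 * r1] in each coordinate. *)
  exists (del / 2); first by rewrite divr_gt0.
  move=> c1 r1 /andP[r1p r1d] _ xc1; exists s => // y yc1; apply: H => i.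
  by have := xc1 i; have := yc1 i; rewrite !ler_norml; lra.
Qed.

End Nondivergence.

(** * Norms of decomposable multivectors *)

Section Wedge.
Variable R : realType.

Definition increasing (j N : nat) (s : {ffun 'I_j -> 'I_N}) :=
  [forall k : 'I_j, forall l : 'I_j, (k < l)%N ==> (s k < s l)%N].

Lemma increasingP j N (s : {ffun 'I_j -> 'I_N}) :
  reflect (forall k l : 'I_j, (k < l)%N -> (s k < s l)%N) (increasing s).
Proof.
apply: (iffP forallP) => H k; first by move=> l kl; move/forallP: (H k) => /(_ l)/implyP/(_ kl).
by apply/forallP => l; apply/implyP; apply: H.
Qed.

Lemma increasing_inj j N (s : {ffun 'I_j -> 'I_N}) : increasing s -> injective s.
Proof.
move=> /increasingP H k l skl; apply: val_inj => /=.
by case: (ltngtP k l) => // /H; rewrite skl ltnn.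
Qed.

Lemma sort_injection j N (s : 'I_j -> 'I_N) : injective s ->
  exists (e : {ffun 'I_j -> 'I_N}) (p : 'S_j), increasing e /\ forall k, s k = e (p k).
Proof.
move=> sinj; pose A : {set 'I_N} := (s @: finset.setTfor 'I_j)%SET.
have cA : size (enum A) = j by rewrite -cardE card_imset// cardsT card_ord.
have sA k : s k \in enum A by rewrite mem_enum imset_f ?inE.
have iA k : (index (s k) (enum A) < j)%N by rewrite -[X in (_ < X)%N]cA index_mem.
pose q k := Ordinal (iA k).
have qinj : injective q.
  move=> k l /(congr1 val)/= E; apply: sinj.
  by rewrite -[s k](nth_index (s k) (sA k)) E nth_index.
pose e := [ffun k : 'I_j => nth (s k) (enum A) k].
exists e, (perm qinj); split.
  apply/increasingP => k l kl; rewrite !ffunE.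
  rewrite (set_nth_default (s l)) ?cA//.
  have tr : transitive (relpre (@nat_of_ord N) ltn) by move=> a b c; apply: ltn_trans.
  have : sorted (relpre (@nat_of_ord N) ltn) (enum A).
    have -> : enum A = [seq x <- enum 'I_N | x \in A] by rewrite enumT.
    apply: sorted_filter tr _ _ _.
    by rewrite -sorted_map val_enum_ord iota_ltn_sorted.
  by move=> srt; apply: (sorted_ltn_nth tr (s l) srt); rewrite ?inE ?cA.
by move=> k; rewrite ffunE permE /= nth_index.
Qed.

Lemma wedge_norm_ge0 N j (M : 'M[R]_(N, j)) : 0 <= wedge_norm M.
Proof. exact: bigmax_ge_id. Qed.

(** A repeated row makes the minor vanish; otherwise sorting the rows only changes its sign. *)
Lemma minor_le_wedge_norm N j (M : 'M[R]_(N, j)) (s : 'I_j -> 'I_N) :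
  `|\det (rowsub s M)| <= wedge_norm M.
Proof.
have [/injectiveP sinj|/injectivePn[k [l kl skl]]] := boolP (injectiveb s); last first.
  rewrite (determinant_alternate kl) ?normr0 ?wedge_norm_ge0// => i.
  by rewrite !mxE skl.
have [e [p [einc sep]]] := sort_injection sinj.
have -> : rowsub s M = row_perm p (rowsub e M).
  by apply/matrixP => i k; rewrite !mxE sep.
rewrite row_permE det_mulmx det_perm normrM normr_sign mul1r.
by rewrite /wedge_norm (bigmaxD1 e)?le_max ?lexx.
Qed.

Lemma wedge_norm_le N j (M : 'M[R]_(N, j)) b : 0 <= b ->
  (forall s : {ffun 'I_j -> 'I_N}, increasing s -> `|\det (rowsub s M)| <= b) ->
  wedge_norm M <= b.
Proof. by move=> b0 H; apply: bigmax_le. Qed.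

Lemma wedge_norm_attained N j (M : 'M[R]_(N, j)) : wedge_norm M = 0 \/
  exists2 s : {ffun 'I_j -> 'I_N}, increasing s & wedge_norm M = `|\det (rowsub s M)|.
Proof.
rewrite /wedge_norm; apply: (big_ind (fun x => x = 0 \/
  exists2 s : {ffun 'I_j -> 'I_N}, increasing s & x = `|\det (rowsub s M)|)).
- by left.
- by move=> x y Hx Hy; case: leP.
- by move=> s sinc; right; exists s.
Qed.

Lemma wedge_norm_mul N j (M : 'M[R]_(N, j)) (C : 'M[R]_j) :
  wedge_norm (M *m C) = wedge_norm M * `|\det C|.
Proof.
have E (s : 'I_j -> 'I_N) : `|\det (rowsub s (M *m C))| = `|\det (rowsub s M)| * `|\det C|.
  by rewrite -mul_rowsub_mx det_mulmx normrM.
apply/eqP; rewrite eq_le; apply/andP; split.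
  apply: wedge_norm_le => [|s _]; first by rewrite mulr_ge0// wedge_norm_ge0.
  by rewrite E ler_wpM2r// minor_le_wedge_norm.
have [->|C0] := eqVneq (\det C) 0; first by rewrite normr0 mulr0 wedge_norm_ge0.
rewrite -ler_pdivlMr ?normr_gt0//; apply: wedge_norm_le => [|s _].
  by rewrite divr_ge0// wedge_norm_ge0.
by rewrite ler_pdivlMr ?normr_gt0// -E minor_le_wedge_norm.
Qed.

Lemma wedge_norm_gt0 N j (M : 'M[R]_(N, j)) : \rank M = j -> 0 < wedge_norm M.
Proof.
move=> /eqP rM; have fM : row_full M by [].
apply: lt_le_trans (minor_le_wedge_norm M (fullrankfun fM)).
by rewrite normr_gt0 -unitfE -unitmxE fullrowsub_unit.
Qed.

Lemma wedge_norm_square N (M : 'M[R]_N) : `|\det M| <= wedge_norm M.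
Proof. by have := minor_le_wedge_norm M id; rewrite mxsub_id. Qed.

(** Laplace expansion of each minor along the column [v]. *)
Lemma wedge_norm_cons N j (v : 'cV[R]_N) (M : 'M[R]_(N, j)) b :
  (forall i, `|v i 0| <= b) -> 0 <= b ->
  wedge_norm (row_mx v M) <= j.+1%:R * b * wedge_norm M.
Proof.
move=> vb b0; apply: wedge_norm_le => [|s _].
  by rewrite !mulr_ge0// wedge_norm_ge0.
rewrite (expand_det_col _ ord0); apply: le_trans (ler_norm_sum _ _ _) _.
apply: (@le_trans _ _ (\sum_(i < 1 + j) b * wedge_norm M)).
  apply: ler_sum => i _; rewrite normrM; apply: ler_pM => //.
    rewrite !mxE; case: splitP => [k _|k /eqP]; last by [].
    by rewrite [k]ord1; apply: vb.
  rewrite normrM normr_sign mul1r.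
  rewrite (_ : row' i _ = rowsub (fun k => s (lift i k)) M) ?minor_le_wedge_norm//.
  apply/matrixP => k l; rewrite !mxE; case: splitP => [k'|k' /=].
    by rewrite ord1.
  by rewrite /bump/= add1n => -[] /val_inj->.
by rewrite sumr_const card_ord -[leLHS]mulr_natl mulrA lexx.
Qed.

Definition intmx N j (V : 'M[int]_(N, j)) : 'M[R]_(N, j) := map_mx (fun z : int => z%:~R) V.

Lemma intmxM N j k (V : 'M[int]_(N, j)) (W : 'M[int]_(j, k)) :
  intmx (V *m W) = intmx V *m intmx W.
Proof. exact: (map_mxM (intr : int -> R)). Qed.

Lemma det_intmx j (V : 'M[int]_j) : \det (intmx V) = (\det V)%:~R.
Proof. exact: (det_map_mx (intr : int -> R)). Qed.

(** Integer minors make the norm a natural number, so a minimal one exists by well-ordering. *)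
Lemma wedge_norm_int N j (V : 'M[int]_(N, j)) : exists k : nat, wedge_norm (intmx V) = k%:R.
Proof.
have [->|[s _ ->]] := wedge_norm_attained (intmx V); first by exists 0%N.
exists `|\det (rowsub s V)|%N.
rewrite (_ : rowsub s (intmx V) = intmx (rowsub s V)); last by apply/matrixP => i k; rewrite !mxE.
by rewrite det_intmx -intr_norm -abszE.
Qed.

(** Transposes turn column spaces into the row spaces that [<=] compares. Such matrices play the
    role of bases of primitive subgroups. *)
Definition minimal N j (V : 'M[int]_(N, j)) : Prop :=
  \rank (intmx V) = j /\ forall W : 'M[int]_(N, j),
    \rank (intmx W) = j -> ((intmx W)^T <= (intmx V)^T)%MS ->
    wedge_norm (intmx V) <= wedge_norm (intmx W).

Lemma eqmx_full_rank N j (V W : 'M[R]_(N, j)) : \rank V = j -> \rank W = j ->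
  (W^T <= V^T)%MS -> (V^T <= W^T)%MS.
Proof.
by move=> rV rW WV; have [_ <-] := mxrank_leqif_sup WV; rewrite !mxrank_tr rV rW eqxx.
Qed.

Lemma exists_minimal N j (V : 'M[int]_(N, j)) : \rank (intmx V) = j ->
  exists W : 'M[int]_(N, j), minimal W /\ ((intmx V)^T <= (intmx W)^T)%MS /\
    ((intmx W)^T <= (intmx V)^T)%MS.
Proof.
move=> rV.
pose P (k : nat) := `[< exists W : 'M[int]_(N, j), [/\ \rank (intmx W) = j,
  ((intmx W)^T <= (intmx V)^T)%MS & wedge_norm (intmx W) = k%:R] >].
have exP : exists k, P k.
  have [k Vk] := wedge_norm_int V; exists k; apply/asboolP; exists V; split=> //.
case: (ex_minnP exP) => k /asboolP[W [rW WV Wk]] kmin.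
have VW := eqmx_full_rank rV rW WV.
exists W; split=> //; split=> // W' rW' W'W.
have [k' W'k'] := wedge_norm_int W'; rewrite Wk W'k' ler_nat; apply: kmin.
by apply/asboolP; exists W'; split=> //; apply: submx_trans WV.
Qed.

Lemma minimal_le N j (V W : 'M[int]_(N, j)) (g : 'M[R]_N) : minimal V ->
  \rank (intmx W) = j -> ((intmx W)^T <= (intmx V)^T)%MS ->
  wedge_norm (g *m intmx V) <= wedge_norm (g *m intmx W).
Proof.
move=> [rV minV] rW WV; have := minV _ rW WV.
have [C WC] := submxP WV.
have -> : intmx W = intmx V *m C^T by rewrite -[LHS]trmxK WC trmx_mul trmxK.
rewrite wedge_norm_mul ler_pMr ?wedge_norm_gt0// => C1.
by rewrite mulmxA wedge_norm_mul ler_peMr// wedge_norm_ge0.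
Qed.

End Wedge.

(** * A Minkowski bound for sublattices *)

Section Minkowski.
Variable R : realType.
Local Notation intmx := (@intmx R).

Definition supnorm (N : nat) (v : 'cV[R]_N) : R := \big[Num.max/0]_i `|v i 0|.

Lemma supnorm_ge0 N (v : 'cV[R]_N) : 0 <= supnorm v.
Proof. exact: bigmax_ge_id. Qed.

Lemma le_supnorm N (v : 'cV[R]_N) i : `|v i 0| <= supnorm v.
Proof. exact: (le_bigmax 0 (fun i => `|v i 0|)). Qed.

Lemma supnorm_le N (v : 'cV[R]_N) b : 0 <= b -> (forall i, `|v i 0| <= b) -> supnorm v <= b.
Proof. by move=> b0 H; apply: bigmax_le. Qed.

Lemma supnorm_attained N (v : 'cV[R]_N) : 0 < supnorm v -> exists i, supnorm v = `|v i 0|.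
Proof.
suff : supnorm v = 0 \/ exists i, supnorm v = `|v i 0| by case=> // ->; rewrite ltxx.
rewrite /supnorm; apply: (big_ind (fun x => x = 0 \/ exists i, x = `|v i 0|)).
- by left.
- by move=> x y Hx Hy; case: leP.
- by move=> i _; right; exists i.
Qed.

Lemma supnormZ N a (v : 'cV[R]_N) : supnorm (a *: v) = `|a| * supnorm v.
Proof.
apply/eqP; rewrite eq_le; apply/andP; split.
  apply: supnorm_le => [|i]; first by rewrite mulr_ge0// supnorm_ge0.
  by rewrite mxE normrM ler_wpM2l// le_supnorm.
have [/supnorm_attained[i ->]|le] := ltP 0 (supnorm v).
  by have := le_supnorm (a *: v) i; rewrite mxE normrM.
have -> : supnorm v = 0 by apply/eqP; rewrite eq_le le supnorm_ge0.
by rewrite mulr0 supnorm_ge0.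
Qed.

Lemma intunit_norm (z : int) : z \is a GRing.unit -> `|z| = 1.
Proof. by move=> /pred2P[] ->. Qed.

Lemma intmx_eq0 N j (V : 'M[int]_(N, j)) : (intmx V == 0) = (V == 0).
Proof.
apply/eqP/eqP => [/matrixP H|->]; last by apply/matrixP => i k; rewrite !mxE.
by apply/matrixP => i k; have /eqP := H i k; rewrite !mxE intr_eq0 => /eqP.
Qed.

(** The Smith form of a column has at most one nonzero entry, so the column is a multiple of the
    first column of a unimodular matrix. *)
Lemma primitive_completion j (c : 'cV[int]_(1 + j)) :
  exists (L : 'M[int]_(1 + j)) (a : int), L \in unitmx /\ c = a *: lsubmx L.
Proof.
have [L uL [U _ [d _ ->]]] := int_Smith_normal_form c.
exists L, (d`_0 * U 0 0); split=> //.
apply/matrixP => i k; rewrite [k]ord1 !mxE big_ord1 !mxE (bigD1 ord0)//= !mxE /= mulr1n.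
rewrite big1 ?addr0; last first.
  by move=> l l0; rewrite !mxE; case: eqP => [E|]; rewrite ?mulr0n ?mulr0//; case/eqP: l0; apply: val_inj.
rewrite (_ : lshift j 0 = ord0); last exact: val_inj.
by rewrite -mulrA mulrC.
Qed.

Lemma wedge_norm_unimodular N j (M : 'M[R]_(N, j)) (L : 'M[int]_j) : L \in unitmx ->
  wedge_norm (M *m intmx L) = wedge_norm M.
Proof.
rewrite unitmxE => /intunit_norm L1.
by rewrite wedge_norm_mul det_intmx -intr_norm L1 mulr1.
Qed.

(** Subtracting multiples of [v] clears row [i] of [W] by a column operation of determinant 1; a
    minor through row [i] is then [v i] times a minor of the cleared matrix. *)
Lemma wedge_norm_pivot N j (v : 'cV[R]_N) (W : 'M[R]_(N, j)) i : v i 0 != 0 ->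
  `|v i 0| * wedge_norm (W - (v i 0)^-1 *: (v *m row i W)) <= wedge_norm (row_mx v W).
Proof.
move=> vi0; set W' := W - _.
have Wi k : W' i k = 0 by rewrite !mxE big_ord1 !mxE mulrA mulVf// mul1r subrr.
have -> : wedge_norm (row_mx v W) = wedge_norm (row_mx v W').
  pose E : 'M[R]_(1 + j) := block_mx 1%:M (- (v i 0)^-1 *: row i W) 0 1%:M.
  have -> : row_mx v W' = row_mx v W *m E.
    rewrite mul_row_block !mulmx1 mulmx0 addr0 -scalemxAr scaleNr.
    by congr (row_mx _ _); rewrite /W' addrC.
  by rewrite wedge_norm_mul det_ublock !det1 mulr1 normr1 mulr1.
have [->|[s _ ->]] := wedge_norm_attained W'; first by rewrite mulr0 wedge_norm_ge0.
pose s1 (k : 'I_(1 + j)) : 'I_N := match fintype.split k with inl _ => i | inr l => s l end.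
suff -> : `|v i 0| * `|\det (rowsub s W')| = `|\det (rowsub s1 (row_mx v W'))|.
  exact: minor_le_wedge_norm.
have -> : rowsub s1 (row_mx v W') = block_mx (v i 0)%:M 0 (rowsub s v) (rowsub s W').
  apply/matrixP => k l; rewrite !mxE /s1; case: (fintype.split k) => k'; rewrite !mxE.
    by case: (fintype.split l) => l'; rewrite ?ord1 ?Wi mxE ?mulr1n.
  by case: (fintype.split l) => l'; rewrite !mxE.
by rewrite det_lblock det_scalar1 normrM.
Qed.

(** The slack [3 / 2] over the infimum replaces a proof that the minimum is attained. *)
Lemma exists_nearly_shortest N j (M : 'M[R]_(N, j)) lam : 0 < lam ->
  (exists c : 'cV[int]_j, c != 0) ->
  (forall c : 'cV[int]_j, c != 0 -> lam <= supnorm (M *m intmx c)) ->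
  exists m, [/\ lam <= m, forall c : 'cV[int]_j, c != 0 -> m <= supnorm (M *m intmx c) &
    exists2 c : 'cV[int]_j, c != 0 & supnorm (M *m intmx c) < 3 / 2 * m].
Proof.
move=> lam0 [c1 c1n0] H.
pose A := [set supnorm (M *m intmx c) | c in [set c : 'cV[int]_j | c != 0]].
have infA : has_inf A.
  by split; [exists (supnorm (M *m intmx c1)), c1 | exists lam => _ [c c0 <-]; apply: H].
have lamA : lam <= inf A by apply: (lb_le_inf infA.1) => _ [c c0 <-]; apply: H.
exists (inf A); split=> //.
  by move=> c c0; apply: ge_inf; [exact: infA.2 | exists c].
have e0 : 0 < inf A / 2 by rewrite divr_gt0// (lt_le_trans lam0).
have [_ [c c0 <-] lt] := inf_adherent e0 infA.
by exists c => //; apply: lt_le_trans lt _; lra.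
Qed.

(* Hermite's induction: complete a nearly shortest vector to a basis and project
   along it, killing its largest coordinate; nonzero projected vectors have norm at
   least a quarter of the minimum. *)
Lemma wedge_norm_lower_bound j : exists2 kap : R, 0 < kap &
  forall N (M : 'M[R]_(N, j)) lam, 0 < lam ->
  (forall c : 'cV[int]_j, c != 0 -> lam <= supnorm (M *m intmx c)) ->
  kap * lam ^+ j <= wedge_norm M.
Proof.
elim: j => [|j [kap kap0 IH]].
  exists 1 => // N M lam _ _; rewrite expr0 mulr1.
  have f (k : 'I_0) : 'I_N by case: k.
  by have := minor_le_wedge_norm M f; rewrite det_mx00 normr1.
exists (kap / 4 ^+ j); first by rewrite divr_gt0// exprn_gt0.
move=> N M lam lam0 H.
have [|m [lm mH [c c0 cm]]] := exists_nearly_shortest lam0 _ H.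
  by exists (const_mx 1); apply/eqP => /matrixP/(_ ord0 ord0)/eqP; rewrite !mxE.
have m0 : 0 < m by apply: lt_le_trans lm.
have [L [a [uL ca]]] := primitive_completion (c : 'cV[int]_(1 + j)).
pose b : 'cV[int]_(1 + j) := lsubmx L.
have ca' : c = a *: b by [].
have a0 : a != 0 by apply: contraNneq c0 => a0; rewrite ca' a0 scale0r.
have b0 : b != 0 by apply: contraNneq c0 => b0; rewrite ca' b0 scaler0.
have nc : supnorm (M *m intmx c) = `|a|%:~R * supnorm (M *m intmx b).
  rewrite ca' (_ : intmx (a *: b) = a%:~R *: intmx b) -?scalemxAr ?supnormZ ?intr_norm//.
  by apply/matrixP => i k; rewrite !mxE intrM.
have bm : supnorm (M *m intmx b) < 3 / 2 * m.
  apply: le_lt_trans cm; rewrite nc ler_peMl ?supnorm_ge0//.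
  by rewrite (ler_int _ 1) -gtz0_ge1 normr_gt0.
pose M1 := M *m intmx L.
pose v : 'cV[R]_N := lsubmx (M1 : 'M[R]_(N, 1 + j)); pose W : 'M[R]_(N, j) := rsubmx (M1 : 'M[R]_(N, 1 + j)).
have M1E : M1 = row_mx v W by rewrite hsubmxK.
have vb : v = M *m intmx b.
  rewrite /v /M1; apply/matrixP => i k; rewrite !mxE; apply: eq_bigr => l _.
  by rewrite !mxE.
have vm : m <= supnorm v by rewrite vb; apply: mH.
have [i vi] := supnorm_attained (lt_le_trans m0 vm).
have vi0 : v i 0 != 0 by rewrite -normr_gt0 -vi (lt_le_trans m0 vm).
rewrite -(wedge_norm_unimodular M uL) -/M1 M1E.
apply: le_trans (wedge_norm_pivot W vi0); set W' := W - _.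
have : kap * (m / 4) ^+ j <= wedge_norm W'.
  apply: IH => [|c' c'0]; first by rewrite divr_gt0.
  (* The projection removes [th * v]. Rounding [th] to the integer [k] gives a nonzero lattice
     vector, of norm at least [m]; the rounding changes coordinates by at most [1/2 * (3/2 * m)],
     which leaves [m / 4]. *)
  pose th := (W *m intmx c') i 0 / v i 0.
  pose k := Num.floor (th + 1 / 2).
  have W'c : W' *m intmx c' = W *m intmx c' - th *: v.
    rewrite mulmxBl -scalemxAl -mulmxA; congr (_ - _).
    have -> : row i W *m intmx c' = ((W *m intmx c') i 0)%:M.
      by rewrite -row_mul; apply/matrixP => p q; rewrite !ord1 !mxE mulr1n.
    by rewrite mul_mx_scalar scalerA mulrC.
  pose c2 : 'cV[int]_(1 + j) := col_mx (- k)%:M c'.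
  have Mc2 : M *m intmx (L *m c2) = W *m intmx c' - k%:~R *: v.
    rewrite intmxM mulmxA -/M1 M1E.
    have -> : intmx c2 = col_mx (- k%:~R)%:M (intmx c').
      rewrite /intmx map_col_mx; congr col_mx.
      by apply/matrixP => p q; rewrite !ord1 !mxE !mulr1n intrN.
    by rewrite mul_row_col mul_mx_scalar scaleNr addrC.
  have c20 : L *m c2 != 0.
    apply: contraNneq c'0 => Lc2; have : c2 = 0 by rewrite -[c2](mulKmx uL) Lc2 mulmx0.
    by move=> /(congr1 dsubmx); rewrite col_mxKd => ->; apply/eqP/matrixP => p q; rewrite !mxE.
  have := mH _ c20; rewrite Mc2 => mle.
  have [p pE] := supnorm_attained (lt_le_trans m0 mle).
  apply: le_trans (le_supnorm _ p); rewrite W'c.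
  pose w := (W *m intmx c') p 0.
  have E x : (W *m intmx c' - x *: v) p 0 = w - x * v p 0.
    by rewrite [LHS]mxE [X in _ + X]mxE [X in - X]mxE.
  move: mle; rewrite pE !E => mle.
  have vp := le_supnorm v p; rewrite {2}vb in vp.
  have thk : `|th - k%:~R| <= 1 / 2.
    have /andP[h1 h2] := floor_itv (th + 1 / 2).
    by move: h1 h2; rewrite -/k intrD ler_norml; lra.
  have -> : w - th * v p 0 = (w - k%:~R * v p 0) - (th - k%:~R) * v p 0 by ring.
  apply: le_trans (lerB_dist _ _).
  have : `|(th - k%:~R) * v p 0| <= 1 / 2 * (3 / 2 * m).
    by rewrite normrM; apply: ler_pM => //; apply: ltW; apply: le_lt_trans vp bm.
  lra.
move=> le; apply: (@le_trans _ _ (m * (kap * (m / 4) ^+ j))); last first.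
  apply: ler_pM => //; first exact: ltW.
    by rewrite mulr_ge0 ?exprn_ge0 ?divr_ge0 ?(ltW kap0) ?(ltW m0).
  by rewrite -vi.
rewrite expr_div_n exprS [leLHS](_ : _ = lam * (kap * (lam ^+ j / 4 ^+ j))); last by ring.
apply: ler_pM => //; first exact: ltW.
  by rewrite mulr_ge0 ?divr_ge0 ?exprn_ge0 ?(ltW kap0) ?(ltW lam0).
rewrite ler_pM2l// ler_pM2r ?invr_gt0 ?exprn_gt0//.
by apply: lerXn2r => //; rewrite nnegrE ltW.
Qed.

End Minkowski.

(** * The flow and Dani's correspondence *)

Section Flow.
Variables (R : realType) (n : nat).
Local Notation intmx := (@intmx R).

Definition gu (t : R) (y : 'rV[R]_n) : 'M[R]_(1 + n) := g_mx n t *m u_mx y.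

Lemma guE t y : gu t y = block_mx (expR t)%:M (expR t *: y) 0 (expR (- t / n%:R))%:M.
Proof.
by rewrite /gu mulmx_block !mulmx0 !mul0mx !mulmx1 !addr0 add0r mul_scalar_mx.
Qed.

Lemma gu_top t y j (W : 'M[R]_(1 + n, j)) l :
  (gu t y *m W) (lshift n 0) l =
  expR t * (W (lshift n 0) l + \sum_i y 0 i * W (rshift 1 i) l).
Proof.
rewrite guE mxE big_split_ord/= big_ord1 block_mxEul mxE mulr1n mulrDr; congr (_ + _).
by rewrite big_distrr/=; apply: eq_bigr => i _; rewrite block_mxEur mxE mulrA.
Qed.

Lemma gu_bot t y j (W : 'M[R]_(1 + n, j)) i l :
  (gu t y *m W) (rshift 1 i) l = expR (- t / n%:R) * W (rshift 1 i) l.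
Proof.
rewrite guE mxE big_split_ord/= big_ord1 block_mxEdl mxE mul0r add0r (bigD1 i)//=.
rewrite block_mxEdr mxE eqxx mulr1n big1 ?addr0// => k ki.
by rewrite block_mxEdr mxE eq_sym (negbTE ki) mul0r.
Qed.

Lemma det_gu t y : (0 < n)%N -> \det (gu t y) = 1.
Proof.
move=> n0; rewrite guE det_ublock det_scalar1 det_scalar -expRM_natl -expRD.
by rewrite mulrCA divff ?mulr1 ?subrr ?expR0// pnatr_eq0 -lt0n.
Qed.

(** [y] enters only the top row of [gu t y *m W], and distinct rows use it at most once. *)
Lemma minor_affine t j (W : 'M[R]_(1 + n, j)) (s : {ffun 'I_j -> 'I_(1 + n)}) :
  injective s -> exists (c0 : R) (c : 'rV[R]_n), forall y,
    \det (rowsub s (gu t y *m W)) = c0 + \sum_i c 0 i * y 0 i.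
Proof.
move=> sinj; have [[k sk]|nk] := pselect (exists k, s k = lshift n 0); last first.
  exists (\det (rowsub s (gu t 0 *m W))), 0 => y.
  rewrite big1 ?addr0; last by move=> i _; rewrite mxE mul0r.
  congr (\det _); apply/matrixP => a b; rewrite ![rowsub _ _ _ _]mxE.
  case: (split_ordP (s a)) => i si; last by rewrite si !gu_bot.
  by case: nk; exists a; rewrite si ord1.
(* These cofactors avoid the top row, so they may be computed at [y = 0]. *)
pose cof l := cofactor (rowsub s (gu t 0 *m W)) k l.
exists (\sum_l expR t * W (lshift n 0) l * cof l),
  (\row_i \sum_l expR t * W (rshift 1 i) l * cof l) => y.
rewrite (expand_det_row _ k) (eq_bigr (fun l => expR t * W (lshift n 0) l * cof l +
  \sum_i y 0 i * (expR t * W (rshift 1 i) l * cof l))).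
  rewrite big_split/= exchange_big/=; congr (_ + _); apply: eq_bigr => i _.
  by rewrite -big_distrr/= mulrC mxE.
move=> l _; rewrite mxE sk gu_top.
have -> : cofactor (rowsub s (gu t y *m W)) k l = cof l.
  rewrite /cof /cofactor; congr (_ * \det _); apply/matrixP => a b; rewrite !mxE.
  have : s (lift k a) != lshift n 0 by rewrite -sk (inj_eq sinj) eq_sym neq_lift.
  case: (split_ordP (s (lift k a))) => i si; first by rewrite si [i]ord1 eqxx.
  by move=> _; have := gu_bot t y W i (lift l b); have := gu_bot t 0 W i (lift l b);
    rewrite !mxE -si => -> ->.
rewrite mulrDr mulrDl; congr (_ + _).
by rewrite big_distrr/= big_distrl/=; apply: eq_bigr => i _; ring.
Qed.

(** The minor attaining the norm at [y0] supplies the good function that [psi_good] asks for. *)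
Lemma wedge_norm_affine t j (W : 'M[R]_(1 + n, j)) (y0 : 'rV[R]_n) :
  exists (c0 : R) (c : 'rV[R]_n),
    `|c0 + \sum_i c 0 i * y0 0 i| = wedge_norm (gu t y0 *m W) /\
    forall y : 'rV[R]_n, `|c0 + \sum_i c 0 i * y 0 i| <= wedge_norm (gu t y *m W).
Proof.
have [->|[s /increasing_inj sinj E]] := wedge_norm_attained (gu t y0 *m W).
  exists 0, 0; have E y : 0 + \sum_i (0 : 'rV[R]_n) 0 i * y 0 i = 0 :> R.
    by rewrite add0r big1// => i _; rewrite mxE mul0r.
  by split=> [|y]; rewrite E normr0// wedge_norm_ge0.
have [c0 [c cE]] := minor_affine t W sinj; exists c0, c; split.
  by rewrite -cE E.
by move=> y; rewrite -cE; apply: minor_le_wedge_norm.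
Qed.

End Flow.

(** * Very well approximable vectors and short lattice vectors *)

Section Dani.
Variables (R : realType) (n : nat).
Hypothesis n0 : (0 < n)%N.
Local Notation intmx := (@intmx R).
Implicit Types (y : 'rV[R]_n) (q : 'rV[int]_n).

Definition linform y q : R := \sum_(i < n) y 0 i * (q 0 i)%:~R.

Lemma qnorm_le q (b : R) : 0 <= b -> (forall i, `|q 0 i|%:~R <= b) -> (qnorm q)%:R <= b.
Proof.
move=> b0 H; rewrite /qnorm; apply: (big_ind (fun m : nat => m%:R <= b)) => //.
  by move=> x z xb zb; rewrite /maxn; case: ifP.
by move=> i _; have := H i; rewrite -abszE.
Qed.

Lemma le_qnorm q i : (`|q 0%R i|%N <= qnorm q)%N.
Proof. exact: (leq_bigmax (F := fun i => `|q ord0 i|%N)). Qed.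

Lemma qnorm_gt0 q : q != 0 -> (0 < qnorm q)%N.
Proof.
rewrite lt0n; apply: contraNneq => q0; apply/eqP/matrixP => i k; rewrite [i]ord1 mxE.
by apply/eqP; rewrite -absz_eq0 -leqn0; apply: leq_trans (le_qnorm q k) _; rewrite q0.
Qed.

Definition zcol (p : int) q : 'cV[int]_(1 + n) := col_mx p%:M q^T.

Lemma gu_zcol_top t y p q :
  (gu t y *m intmx (zcol p q)) (lshift n 0) 0 = expR t * (linform y q + p%:~R).
Proof.
rewrite gu_top mxE /zcol col_mxEu mxE eqxx mulr1n addrC; congr (_ * (_ + _)).
by apply: eq_bigr => i _; rewrite mxE col_mxEd mxE.
Qed.

Lemma gu_zcol_bot t y p q i :
  (gu t y *m intmx (zcol p q)) (rshift 1 i) 0 = expR (- t / n%:R) * (q 0 i)%:~R.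
Proof. by rewrite gu_bot mxE /zcol col_mxEd mxE. Qed.

Lemma zcolK (z : 'cV[int]_(1 + n)) : z = zcol (z (lshift n 0) 0) (dsubmx z)^T.
Proof.
rewrite /zcol trmxK -[LHS]vsubmxK; congr col_mx.
by apply/matrixP => i k; rewrite [i]ord1 [k]ord1 !mxE eqxx mulr1n.
Qed.

Lemma dist_int_gt0 (x : R) : (forall p : int, x + p%:~R != 0) ->
  exists2 del, 0 < del & forall p : int, del <= `|x + p%:~R|.
Proof.
move=> H; have /andP[fx xf] := floor_itv x; set m := Num.floor x in fx xf.
have fx' : m%:~R < x.
  rewrite lt_neqAle fx andbT; apply: contraNneq (H (- m)) => <-.
  by rewrite intrN subrr.
rewrite intrD in xf.
exists (Num.min (x - m%:~R) (m%:~R + 1 - x)); first by rewrite lt_min !subr_gt0 fx' xf.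
move=> p; rewrite ge_min; have [pm|mp] := lerP (- m) p.
  have : (- m)%:~R <= p%:~R :> R by rewrite ler_int.
  rewrite intrN => h; apply/orP; left; apply: le_trans (ler_norm _); lra.
have : (p + 1)%:~R <= (- m)%:~R :> R by rewrite ler_int lezD1.
rewrite intrN intrD => h; apply/orP; right; rewrite -normrN; apply: le_trans (ler_norm _); lra.
Qed.

Lemma finite_gap y (s : seq 'rV[int]_n) :
  (forall q (p : int), q != 0 -> linform y q + p%:~R != 0) ->
  exists2 del, 0 < del & forall q (p : int), q \in s -> q != 0 -> del <= `|linform y q + p%:~R|.
Proof.
move=> H; elim: s => [|q s [d1 d10 IH]]; first by exists 1.
have [->|q0] := eqVneq q 0.
  by exists d1 => // q' p; rewrite inE => /orP[/eqP->|]; [rewrite eqxx | exact: IH].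
have [d2 d20 IH2] := dist_int_gt0 (H q ^~ q0).
exists (Num.min d1 d2); first by rewrite lt_min d10.
move=> q' p; rewrite inE ge_min => /orP[/eqP-> _|qs q'0]; first by rewrite IH2 orbT.
by rewrite IH.
Qed.

(* If there were finitely many solutions [q], either some integer form would vanish
   at [y], and so would its multiples, or the forms would be bounded away from [0]. *)
Lemma VWA_of_short_vectors y gam : 0 < gam ->
  (forall T : R, exists2 t, T <= t & exists2 z : 'cV[int]_(1 + n), z != 0 &
     supnorm (gu t y *m intmx z) < expR (- (gam * t))) ->
  VWA y.
Proof.
(* A short vector gives a form below [expR (- (1 + gam) * t)] with [qnorm q <= expR (t / n)]; this
   [v] matches the two exponents. *)
move=> gam0 H; pose v := n%:R * (1 + gam).
have nR : 0 < n%:R :> R by rewrite ltr0n.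
exists v; split; first by rewrite ltr_pMr// ltrDl.
set S := [set q | _].
have short T : 0 <= T -> exists t q (p : int), [/\ T <= t, q != 0,
    `|linform y q + p%:~R| < expR (- ((1 + gam) * t)) & S q].
  move=> T0; have [t Tt [z z0 zs]] := H T.
  pose p := z (lshift n 0) 0; pose q : 'rV[int]_n := (dsubmx z)^T.
  have t0 : 0 <= t by apply: le_trans Tt.
  have gt0 : 0 <= gam * t by rewrite mulr_ge0// ltW.
  have e1 : expR (- (gam * t)) <= 1 by rewrite expR_le1 oppr_le0.
  have zE : z = zcol p q by exact: zcolK.
  have ptop : `|linform y q + p%:~R| < expR (- ((1 + gam) * t)).
    have := le_supnorm (gu t y *m intmx z) (lshift n 0).
    rewrite {1}zE gu_zcol_top normrM (ger0_norm (expR_ge0 t)) => h.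
    have := le_lt_trans h zs; rewrite mulrC -ltr_pdivlMr ?expR_gt0// -expRB.
    by rewrite (_ : - (gam * t) - t = - ((1 + gam) * t))//; ring.
  have qbot i : `|q 0 i|%:~R <= expR (t / n%:R).
    have := le_supnorm (gu t y *m intmx z) (rshift 1 i).
    rewrite {1}zE gu_zcol_bot normrM (ger0_norm (expR_ge0 _)) => h.
    have := le_trans (ltW (le_lt_trans h zs)) e1.
    by rewrite mulrC -ler_pdivlMr ?expR_gt0// mul1r -expRN -intr_norm mulNr opprK.
  (* If [q = 0], then the integer [p] has absolute value below 1, and [z = 0]. *)
  have q0 : q != 0.
    apply: contraNneq z0 => q0; rewrite zE q0.
    suff -> : p = 0 by apply/eqP/matrixP => i k; rewrite mxE; case: splitP => l _; rewrite !mxE ?mul0rn.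
    move: ptop; rewrite q0 /linform big1 ?add0r; last by move=> i _; rewrite mxE mulr0.
    rewrite -intr_norm => h; have : `|p|%:~R < 1 :> R.
      apply: lt_le_trans h _; rewrite expR_le1 oppr_le0 mulr_ge0// addr_ge0//; exact: ltW.
    by rewrite (ltr_int _ _ 1) => p1; apply/eqP; rewrite -normr_le0 -ltzD1 add0r.
  exists t, q, p; split=> //; exists p; apply: ltW; apply: lt_le_trans ptop _.
  have Q0 : 0 < (qnorm q)%:R :> R by rewrite ltr0n qnorm_gt0.
  have -> : - ((1 + gam) * t) = t / n%:R * - v by rewrite /v; field; rewrite gt_eqF.
  rewrite expRM !powRN lef_pV2 ?posrE ?powR_gt0 ?expR_gt0//.
  apply: ge0_ler_powR; rewrite ?nnegrE ?expR_ge0 ?ler0n//.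
    by rewrite mulr_ge0 ?ler0n// addr_ge0// ltW.
  by apply: qnorm_le => //; apply: expR_ge0.
move=> Sfin; have [[q [p [q0 qp]]]|nz] := pselect (exists q (p : int), q != 0 /\ linform y q + p%:~R = 0).
  apply: infinite_nat; rewrite (_ : setT = (fun k : nat => q *+ k) @^-1` S).
    apply: finite_preimage Sfin => k l _ _ kl.
    have [i qi] : exists i, q 0 i != 0.
      apply: contrapT => /forallNP h; case/eqP: q0; apply/matrixP => a b.
      by rewrite [a]ord1 mxE; have /negP := h b; rewrite negbK => /eqP.
    by have /matrixP/(_ 0 i) := kl; rewrite !mulmxnE => /(mulrIn qi).
  apply/seteqP; split=> // k _; exists (p *+ k).
  suff -> : \sum_(i < n) y 0 i * ((q *+ k) 0 i)%:~R + (p *+ k)%:~R = 0.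
    by rewrite normr0 powR_ge0.
  transitivity ((linform y q + p%:~R) *+ k); last by rewrite qp mul0rn.
  rewrite mulrnDl rmorphMn/=; congr (_ + _).
  rewrite /linform -sumrMnl; apply: eq_bigr => i _.
  by rewrite mulmxnE rmorphMn/= mulrnAr.
have [s Ss] := (finite_seqP S).1 Sfin.
have [|del del0 gap] := @finite_gap y s.
  by move=> q p q0; apply/eqP => qp; apply: nz; exists q, p.
have T0 : 0 <= Num.max 0 (- ln del) by rewrite le_max lexx.
have [t [q [p [Tt q0 lt Sq]]]] := short _ T0.
have := gap q p _ q0.
have -> : q \in s by have : S q by []; rewrite Ss.
move=> /(_ isT); apply/negP; rewrite -ltNge; apply: lt_le_trans lt _.
rewrite -[leRHS](lnK del0) ler_expR.
move: Tt; rewrite ge_max => /andP[t0]; nra.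
Qed.

Lemma finite_qnorm_le (H : nat) : finite_set [set q : 'rV[int]_n | (qnorm q <= H)%N].
Proof.
pose F (g : {ffun 'I_n -> 'I_(2 * H).+1}) : 'rV[int]_n := \row_i ((g i)%:Z - H%:Z).
apply: (@sub_finite_set _ _ (F @` setT)); last by apply: finite_image; apply: finite_finset.
move=> q qH; have b i : - H%:Z <= q 0 i <= H%:Z.
  by have := leq_trans (le_qnorm q i) qH; lia.
exists [ffun i => inord `|(q 0 i + H%:Z)%R|%N] => //.
apply/matrixP => a i; rewrite [a]ord1 mxE ffunE inordK; have := b i; lia.
Qed.

(** Rates [1 / (k + 1)] and integer times present the VWA condition as a countable union of limsup
    conditions. *)
Lemma short_vectors_of_VWA y : VWA y -> exists k : nat, forall T : nat,
  exists2 t : nat, (T <= t)%N & exists2 z : 'cV[int]_(1 + n), z != 0 &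
    supnorm (gu t%:R y *m intmx z) <= expR (- (k.+1%:R^-1 * t%:R)).
Proof.
move=> [v [nv inf]].
have nR : 0 < n%:R :> R by rewrite ltr0n.
have v0 : 0 < v by apply: lt_trans nv.
(* Half the rate at which [a] and [b] below would coincide. *)
pose gam0 := (v - n%:R) / (2 * n%:R * (1 + v)).
have den0 : 0 < 2 * n%:R * (1 + v) by rewrite !mulr_gt0// addr_gt0.
have gam00 : 0 < gam0 by rewrite divr_gt0// subr_gt0.
pose k := Num.bound gam0^-1.
have kg : k.+1%:R^-1 <= gam0.
  rewrite -[leRHS]invrK lef_pV2 ?posrE ?invr_gt0 ?ltr0n//.
  have : gam0^-1 < k%:R by apply: archi_boundP; rewrite invr_ge0 ltW.
  by move=> /ltW/le_trans; apply; rewrite ler_nat.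
exists k => T; set gam := k.+1%:R^-1 in kg *.
have gamp : 0 < gam by rewrite invr_gt0 ltr0n.
have gden : gam * (2 * n%:R * (1 + v)) <= v - n%:R by rewrite -ler_pdivlMr.
(* With [lam] the logarithm of [qnorm q], the [q] coordinates are short when [lam <= a * t] and the
   top one when [b * t <= lam]. *)
pose a := n%:R^-1 - gam; pose b := (1 + gam) / v.
have b0 : 0 < b by rewrite divr_gt0// addr_gt0.
have ba : b < a.
  rewrite /b /a ltr_pdivrMr// -(ltr_pM2l nR) mulrA mulrBr divff ?gt_eqF//; nra.
have a0 : 0 < a by apply: lt_trans ba.
have iab : 0 < b^-1 - a^-1 by rewrite subr_gt0 ltf_pV2.
(* For [lam >= Lam] the interval from [lam / a] to [lam / b] has length at least 1 and starts at [T]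
   or later. *)
pose Lam := Num.max (b^-1 - a^-1)^-1 (T%:R * a).
pose H := Num.bound (expR Lam).
have [q [p pq] Hq] : exists2 q, (exists p : int, `|linform y q + p%:~R| <= (qnorm q)%:R `^ (- v)) &
    (H < qnorm q)%N.
  apply: contrapT => /forall2NP nq; apply: inf; apply: sub_finite_set (finite_qnorm_le H) => q qS /=.
  by have [//|/negP] := nq q; rewrite -leqNgt.
have Q0 : 0 < (qnorm q)%:R :> R by rewrite ltr0n (leq_ltn_trans _ Hq).
pose lam := ln (qnorm q)%:R : R.
have lamE : expR lam = (qnorm q)%:R by rewrite lnK.
have Lamlam : Lam <= lam.
  rewrite -ler_expR lamE; apply: ltW; apply: (@lt_trans _ _ H%:R); last by rewrite ltr_nat.
  exact: archi_boundP (expR_ge0 _).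
move: Lamlam; rewrite /Lam ge_max => /andP[L1 L2].
have lam0 : 0 <= lam by apply: le_trans L2; rewrite mulr_ge0 ?ler0n// ltW.
pose t := (Num.truncn (lam / a)).+1.
have la0 : 0 <= lam / a by rewrite divr_ge0// ltW.
have /andP[t1 t2] := truncn_itv la0.
have tlo : lam <= a * t%:R by rewrite mulrC -ler_pdivrMr// ltW.
have thi : b * t%:R <= lam.
  rewrite mulrC -ler_pdivlMr// -natr1; apply: (@le_trans _ _ (lam / a + 1)); first by rewrite lerD2r.
  rewrite -lerBrDl -mulrBr.
  by rewrite -ler_pdivrMr// mul1r.
exists t.
  by rewrite -(ler_nat R); apply: le_trans (ltW t2); rewrite ler_pdivlMr.
exists (zcol p q).
  apply/eqP => /(congr1 dsubmx); rewrite col_mxKd => /(congr1 trmx); rewrite trmxK => qz.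
  move: Hq; suff -> : qnorm q = 0%N by [].
  apply/eqP; rewrite -leqn0; apply/bigmax_leqP => i _.
  by rewrite qz !mxE.
apply: supnorm_le => [|i]; first exact: expR_ge0.
case: (split_ordP i) => {}i ->.
  rewrite [i]ord1 gu_zcol_top normrM ger0_norm ?expR_ge0//.
  apply: le_trans (ler_wpM2l (expR_ge0 _) pq) _.
  rewrite -lamE -expRM -expRD ler_expR.
  move: thi; rewrite /b mulrAC ler_pdivrMr//; lra.
rewrite gu_zcol_bot normrM ger0_norm ?expR_ge0//.
apply: (@le_trans _ _ (expR (- t%:R / n%:R) * expR lam)).
  rewrite ler_wpM2l ?expR_ge0// lamE -intr_norm.
  by rewrite -abszE ler_nat le_qnorm.
rewrite -expRD ler_expR; move: tlo; rewrite /a mulNr; lra.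
Qed.

End Dani.

(** * Chains of subgroups and short vectors *)

Section Flags.
Variables (R : realType) (n : nat).
Local Notation intmx := (@intmx R).

Definition node := {j : nat & 'M[int]_(1 + n, j)}.
Definition mknode (j : nat) (V : 'M[int]_(1 + n, j)) : node := existT (fun j => 'M[int]_(1 + n, j)) j V.
Definition nspan (s : node) : 'M[R]_(tag s, 1 + n) := (intmx (tagged s))^T.
Definition nnorm (G : 'M[R]_(1 + n)) (s : node) : R := wedge_norm (G *m intmx (tagged s)).
(** Requiring distinct ranks makes each step of the recursion use up one rank. *)
Definition node_cmp (s s' : node) : Prop :=
  tag s != tag s' /\ ((nspan s <= nspan s')%MS \/ (nspan s' <= nspan s)%MS).
Definition proper_minimal (s : node) : Prop := (0 < tag s < 1 + n)%N /\ minimal R (tagged s).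

Lemma node_cmp_sym s s' : node_cmp s s' -> node_cmp s' s.
Proof. by move=> [ne [h|h]]; split; rewrite 1?eq_sym//; [right|left]. Qed.

Lemma wedge_norm_full_rank N k (V : 'M[int]_(N, k)) (G : 'M[R]_N) : k = N ->
  \rank (intmx V) = k -> \det G = 1 -> 1 <= wedge_norm (G *m intmx V).
Proof.
move=> kN; subst k => rV dG.
apply: le_trans (wedge_norm_square _); rewrite det_mulmx dG mul1r det_intmx -intr_norm.
rewrite (ler_int _ 1) -gtz0_ge1 normr_gt0 -(intr_eq0 R) -det_intmx -unitfE.
by rewrite -unitmxE -row_full_unit /row_full rV.
Qed.

Lemma intmx_row_mx N j k (V : 'M[int]_(N, j)) (W : 'M[int]_(N, k)) :
  intmx (row_mx V W) = row_mx (intmx V) (intmx W).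
Proof. exact: map_row_mx. Qed.

Lemma wedge_norm_mx0 N (M : 'M[R]_(N, 0)) : wedge_norm M <= 1.
Proof. by apply: wedge_norm_le => // s _; rewrite det_mx00 normr1. Qed.

Section NoShortVector.
Variables (G : 'M[R]_(1 + n)) (F : set node) (eps rho0 : R).
Hypothesis detG : \det G = 1.
Hypothesis FP : forall s, F s -> proper_minimal s /\ eps <= nnorm G s <= 1.
Hypothesis Fchain : forall s s', F s -> F s' -> s = s' \/ node_cmp s s'.
Hypothesis Fmax : forall s, proper_minimal s -> (forall s', F s' -> node_cmp s' s) ->
  rho0 <= nnorm G s.

(* Add [z] to the largest member [s] of the chain not containing it: the result is
   comparable to the whole chain or spans one of its members, and its covolume is
   at most a multiple of [|G z|]. *)
Lemma no_short_vector (z : 'cV[int]_(1 + n)) : z != 0 ->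
  Num.min 1 (Num.min eps rho0) <= n.+1%:R * supnorm (G *m intmx z).
Proof.
(* The zero node [o] serves as bottom of the chain, so that some member does not contain [z]. *)
move=> z0; pose zr := (intmx z)^T; pose o : node := mknode (0 : 'M[int]_(1 + n, 0)).
pose P k := `[< exists s : node, [/\ F s \/ s = o, ~~ (zr <= nspan s)%MS & tag s = k] >].
have exP : exists k, P k.
  exists 0%N; apply/asboolP; exists o; split=> //; first by right.
  have -> : nspan o = 0 by apply/matrixP => -[].
  apply: contra z0 => /submx0null/eqP; by rewrite trmx_eq0 intmx_eq0.
have bP k : P k -> (k <= n)%N.
  by move=> /asboolP[s [[/FP[[/andP[_ ?] _] _]|->] _ <-]].
case: (ex_maxnP exP bP) => j Pj jmax; have jn := bP j Pj.
move: Pj => /asboolP[[j' V] [sF zV]] /= jj; subst j'; set s := mknode V in sF zV.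
have rV : \rank (intmx V) = j.
  case: sF => [/FP[[_ []]//]|so]; have j0 : j = 0%N := congr1 (@tag _ _) so.
  by move: (V); rewrite j0 => V'; apply/eqP; rewrite -leqn0 rank_leq_col.
have sle : nnorm G s <= 1.
  case: sF => [/FP[_ /andP[]]//|so].
  by apply: le_trans (wedge_norm_mx0 (G *m intmx 0)); rewrite (congr1 (nnorm G) so).
pose V' := row_mx z V : 'M[int]_(1 + n, 1 + j).
have V'E : (intmx V')^T = col_mx zr (nspan s) by rewrite intmx_row_mx tr_row_mx.
have sV' : (nspan s <= (intmx V')^T)%MS by rewrite V'E -addsmxE addsmxSr.
have zV' : (zr <= (intmx V')^T)%MS by rewrite V'E -addsmxE addsmxSl.
have V'le k (B : 'M[R]_(k, 1 + n)) : (zr <= B)%MS -> (nspan s <= B)%MS -> ((intmx V')^T <= B)%MS.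
  by move=> zB sB; rewrite V'E col_mx_sub zB.
have rV' : \rank (intmx V') = (1 + j)%N.
  have lt : (\rank (nspan s) < \rank (intmx V')^T)%N.
    by apply: rank_ltmx; rewrite ltmxE sV'; apply: contra zV; exact: submx_trans.
  by rewrite !mxrank_tr rV in lt; apply/eqP; rewrite eqn_leq rank_leq_col.
have up : wedge_norm (G *m intmx V') <= n.+1%:R * supnorm (G *m intmx z).
  rewrite intmx_row_mx mul_mx_row.
  apply: le_trans (wedge_norm_cons _ (le_supnorm _) (supnorm_ge0 _)) _.
  apply: (@le_trans _ _ (j.+1%:R * supnorm (G *m intmx z))).
    by rewrite ler_piMr// mulr_ge0 ?supnorm_ge0.
  by rewrite ler_wpM2r ?supnorm_ge0// ler_nat.
apply: le_trans up; rewrite !ge_min.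
have [jn'|] := eqVneq (1 + j)%N (1 + n)%N; first by rewrite wedge_norm_full_rank.
move=> jn'; have jltn : (1 + j < 1 + n)%N by rewrite ltn_neqAle jn' ltnS.
have [V0 [minV0 [V'V0 V0V']]] := exists_minimal rV'.
have above s1 : F s1 -> (zr <= nspan s1)%MS -> (nspan s <= nspan s1)%MS.
  move=> Fs1 zs1; case: sF => [Fs|so]; last first.
    suff -> : nspan s = 0 by rewrite sub0mx.
    by have j0 : j = 0%N := congr1 (@tag _ _) so; apply/matrixP => -[a aj] b; exfalso;
      move: (aj); rewrite -[X in (_ < X)%N]/j j0.
  have [E|[_ [//|h]]] := Fchain Fs Fs1; first by rewrite -E.
  by case/negP: zV; apply: submx_trans h.
have below s1 : F s1 -> ~~ (zr <= nspan s1)%MS -> (nspan s1 <= nspan s)%MS.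
  move=> Fs1 zs1; have t1 : (tag s1 <= j)%N by apply: jmax; apply/asboolP; exists s1; split=> //; left.
  case: sF => [Fs|so]; last first.
    have j0 : j = 0%N := congr1 (@tag _ _) so.
    have [[/andP[t1p _] _] _] := FP Fs1.
    by have := leq_trans t1p t1; rewrite j0.
  have [E|[ne [h|//]]] := Fchain Fs Fs1; first by rewrite -E.
  have := mxrankS h; rewrite !mxrank_tr rV; have [[_ [-> _]] _] := FP Fs1.
  by move=> t2; case/eqP: ne => /=; apply/eqP; rewrite eqn_leq t1 t2.
(* A chain member of rank [j + 1] has the span of [V']; its norm is at least [eps], and by
   minimality at most that of [V']. *)
have [[s1 Fs1 t1]|no] := pselect (exists2 s1, F s1 & tag s1 = (1 + j)%N).
  have zs1 : (zr <= nspan s1)%MS.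
    apply/negPn/negP => zs1; have := mxrankS (below _ Fs1 zs1).
    by rewrite !mxrank_tr rV; have [[_ [-> _]] _] := FP Fs1; rewrite t1 ltnn.
  have s1V' := V'le _ _ zs1 (above _ Fs1 zs1).
  have [[_ min1] /andP[e1 _]] := FP Fs1.
  case: s1 t1 Fs1 zs1 s1V' min1 e1 => j1 V1 /= t1; subst j1 => Fs1 zs1 s1V' min1 e1.
  by rewrite (le_trans e1) ?orbT// minimal_le.
(* Otherwise the minimal matrix [V0] with the span of [V'] is comparable to the whole chain. *)
suff h : rho0 <= nnorm G (mknode V0).
  by rewrite (le_trans h (minimal_le G minV0 rV' V'V0)) !orbT.
apply: Fmax; first by split.
move=> s1 Fs1; split; first by apply/eqP => t1; apply: no; exists s1.
have [zs1|zs1] := boolP (zr <= nspan s1)%MS; [right|left].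
  by apply: submx_trans V0V' _; apply: V'le => //; apply: above.
by apply: submx_trans (below _ Fs1 zs1) (submx_trans sV' V'V0).
Qed.

End NoShortVector.
End Flags.

(** * Proof of the equivalences *)

Section CubeTopology.
Variables (R : realType) (d : nat).
Implicit Types (x : 'rV[R]_d) (A : set 'rV[R]_d).

Lemma nbhs_cube x A : nbhs x A -> exists2 del, 0 < del & cube x del `<=` A.
Proof.
move=> /nbhs_ballP[e /= e0 eA]; exists (e / 2); first by rewrite divr_gt0.
move=> y yx; apply: eA; split=> // i j; rewrite [i]ord1 -ball_normE/=.
by rewrite distrC; apply: le_lt_trans (yx j) _; rewrite ltr_pdivrMr// ltr_pMr// ltr1n.
Qed.

Lemma cube_nbhs x del : 0 < del -> nbhs x (cube x del).
Proof.
move=> del0; apply/nbhs_ballP; exists del => // y yx i.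
by have := yx.2 0 i; rewrite -ball_normE/= distrC => /ltW.
Qed.

Lemma open_cube x A : open A -> A x -> exists2 del, 0 < del & cube x del `<=` A.
Proof. by move=> oA Ax; apply: nbhs_cube; apply: open_nbhs_nbhs; split. Qed.

End CubeTopology.

(** * Measure of the set of points with a short lattice vector *)

Section ShortVectorMeasure.
Variables (R : realType) (d n : nat) (f : 'rV[R]_d -> 'rV[R]_n) (C al : R) (V : set 'rV[R]_d).
Local Notation intmx := (@intmx R).
Hypotheses (d0 : (0 < d)%N) (n0 : (0 < n)%N) (C0 : 0 < C) (al0 : 0 < al).
Hypothesis fgood : forall (a : R) (c : 'rV[R]_n),
  good_on C al V (fun x => a + \sum_(i < n) c 0 i * f x 0 i).
Variables (c0 : 'rV[R]_d) (r0 : R).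
Hypothesis r00 : 0 < r0.
Hypothesis rootV : cube c0 ((2 * d%:R + 1) * r0) `<=` V.
Hypothesis fcont : forall x, cube c0 r0 x -> {for x, continuous f}.

Lemma affine_cvg x (a : R) (c : 'rV[R]_n) : {for x, continuous f} ->
  a + \sum_i c 0 i * f y 0 i @[y --> x] --> a + \sum_i c 0 i * f x 0 i.
Proof.
move=> fx; have fi i : f y 0 i @[y --> x] --> f x 0 i.
  exact: (cvg_comp _ _ fx (@coord_continuous _ _ _ 0 i (f x))).
have sc : \sum_i c 0 i * f y 0 i @[y --> x] --> \sum_i c 0 i * f x 0 i.
  have addc : continuous (fun p : R^o * R^o => p.1 + p.2) by exact: add_continuous.
  by apply: (@cvg_big _ _ _ _ _ addc _ (nbhs x) _ _ _ (nbhs_filter x)) => i _;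
    exact: (cvgMr (fi i)).
exact: (cvgD (cvg_cst a) sc).
Qed.

(** The norm is a maximum of finitely many minors, each affine in [f] and so continuous. *)
Lemma nnorm_usc t (s : node n) x rho : cube c0 r0 x -> nnorm (gu t (f x)) s < rho ->
  exists2 del, 0 < del & forall y, cube x del y -> nnorm (gu t (f y)) s < rho.
Proof.
move=> xc lt; have fx := fcont xc.
have rho0 : 0 < rho by apply: le_lt_trans lt; apply: wedge_norm_ge0.
suff : \forall y \near x, nnorm (gu t (f y)) s < rho.
  by move=> /nbhs_cube[del del0 H]; exists del.
have H : \forall y \near x, forall s' : {ffun 'I_(tag s) -> 'I_(1 + n)},
    increasing s' -> `|\det (rowsub s' (gu t (f y) *m intmx (tagged s)))| < rho.
  apply: (@filter_forall _ _ _ (nbhs x) (nbhs_filter x)) => s'; have [inc|ninc] := boolP (increasing s'); last first.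
    exact: (@filterS _ (nbhs x) (nbhs_filter x) setT _ _ filterT).
  have [a [c ac]] := minor_affine t (intmx (tagged s)) (increasing_inj inc).
  have := @cvgr_norm_lt _ _ _ (nbhs x) (nbhs_filter x) _ _ (@affine_cvg x a c fx).
  move=> /(_ rho); rewrite -ac => /(_ (le_lt_trans (minor_le_wedge_norm _ _) lt)).
  by apply: (@filterS _ (nbhs x) (nbhs_filter x)) => y; rewrite -ac.
apply: (@filterS _ (nbhs x) (nbhs_filter x) _ _ _ H) => {}y {}H; rewrite /nnorm.
by have [->//|[s' inc ->]] := wedge_norm_attained (gu t (f y) *m intmx (tagged s)); apply: H.
Qed.

(** At a protected point [no_short_vector] excludes nonzero vectors shorter than [eps / (n + 1)];
    the available ranks are [1, ..., n]. *)
Lemma short_vector_measure t rho0 eps : 0 < eps -> eps <= rho0 ->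
  dblconst d C al ^+ n * rho0 <= 1 ->
  (forall s : node n, proper_minimal R s ->
     exists2 y, cube c0 r0 y & dblconst d C al ^+ n * rho0 <= nnorm (gu t (f y)) s) ->
  (leb_outer [set x | cube c0 r0 x /\ exists2 z : 'cV[int]_(1 + n), (z != 0)%R &
     (supnorm (gu t (f x) *m intmx z) < eps / n.+1%:R)%R] <=
   (n%:R * (dimconst d C * (eps / rho0) `^ al) * r0 ^+ d)%:E)%E.
Proof.
move=> eps0 er K1 large.
have rho00 : 0 < rho0 by apply: lt_le_trans er.
have K_ge1 : 1 <= dblconst d C al ^+ n by rewrite exprn_ege1// dblconst_ge1.
have rho1 : rho0 <= 1 by apply: le_trans K1; rewrite ler_peMl// ltW.
pose psi (s : node n) x := nnorm (gu t (f x)) s.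
apply: (@le_trans _ _ (leb_outer [set x | cube c0 r0 x /\
    ~ protected psi (@node_cmp R n) eps rho0 (@proper_minimal R n) x])).
  apply: le_leb_outer => x [xc [z z0 zs]]; split=> // -[F [F1 F2 F3]].
  have := @no_short_vector R n (gu t (f x)) F eps rho0 (det_gu _ _ n0) F1 F2 F3 z z0.
  have -> : Num.min 1 (Num.min eps rho0) = eps.
    by rewrite (min_l er) min_r//; exact: le_trans rho1.
  apply/negP; rewrite -ltNge mulrC.
  by rewrite -ltr_pdivlMr// ltr0n.
apply: (@quantitative_nondivergence _ _ _ _ V _ psi (fun s => tag s) _ c0 r0 _ _ _ _ _ _ _ _ _ _ _ _ _ _ _ _ (iota 1 n)) => //.
- move=> s y; have [a [c [ac le]]] := wedge_norm_affine t (intmx (tagged s)) (f y).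
  by exists (fun x => a + \sum_(i < n) c 0 i * f x 0 i).
- by move=> s x rho; apply: nnorm_usc.
- exact: node_cmp_sym.
- by move=> s s' [].
- by rewrite size_iota.
- by move=> s [/andP[s0 sn] _]; rewrite mem_iota s0.
Qed.

End ShortVectorMeasure.

Lemma borel_cantelli_exp (R : realType) (d : nat) (A : nat -> set 'rV[R]_d) (M s : R) (T1 : nat) :
  0 < M -> 0 < s ->
  (forall t, (T1 <= t)%N -> (leb_outer (A t) <= (M * expR (- (s * t%:R)))%:E)%E) ->
  leb_outer [set x | forall T : nat, exists2 t : nat, (T <= t)%N & A t x] = 0%E.
Proof.
move=> M0 s0 HA; apply/eqP; rewrite eq_le leb_outer_ge0 andbT.
apply/lee_addgt0Pr => e e0; rewrite add0e.
pose th := expR (- s).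
have th0 : 0 < th by apply: expR_gt0.
have th1 : 0 < 1 - th by rewrite subr_gt0 expR_lt1 oppr_lt0.
have thE k : expR (- (s * k%:R)) = th ^+ k by rewrite -mulNr expRM_natr.
(* [X <= expR (s * T)] says exactly that the geometric tail from [T] on is at most [e]. *)
pose X := M / ((1 - th) * e).
have X0 : 0 < X by rewrite divr_gt0// mulr_gt0.
pose T := maxn T1 (Num.bound (X / s)).
have XT : X <= expR (s * T%:R).
  apply: le_trans (expR_ge1Dx _); apply: (@le_trans _ _ (s * T%:R)); last by rewrite lerDr.
  rewrite mulrC -ler_pdivrMr//; apply: ltW.
  apply: (@lt_le_trans _ _ (Num.bound (X / s))%:R); last by rewrite ler_nat leq_maxr.
  by apply: archi_boundP; rewrite divr_ge0// ltW.
have small : M * th ^+ T / (1 - th) <= e.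
  rewrite -thE expRN ler_pdivrMr// ler_pdivrMr ?expR_gt0//.
  by move: XT; rewrite /X ler_pdivrMr ?mulr_gt0// mulrC (mulrC (1 - th)).
apply: (@le_trans _ _ (leb_outer (\bigcup_m A (T + m)%N))).
  apply: le_leb_outer => x /(_ T)[t Tt Atx]; exists (t - T)%N => //.
  by rewrite subnKC.
apply: (le_trans (leb_outer_sigma_subadditive _)).
apply: nneseries_le_bound => k; first exact: leb_outer_ge0.
apply: (@le_trans _ _ (M * th ^+ T * (1 - th ^+ k) / (1 - th))%:E); last first.
  rewrite lee_fin; apply: le_trans small.
  rewrite ler_pM2r ?invr_gt0// ler_piMr//; first by rewrite mulr_ge0 ?exprn_ge0// ltW.
  by rewrite lerBlDr lerDl exprn_ge0// ltW.
elim: k => [|k IH]; first by rewrite big_geq// expr0 subrr mulr0 mul0r.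
rewrite big_nat_recr//=; apply: (le_trans (leeD IH (HA _ _))).
  by rewrite (leq_trans (leq_maxl _ (Num.bound (X / s))))// leq_addr.
rewrite -EFinD lee_fin thE exprD exprS.
have -> : M * th ^+ T * (1 - th ^+ k) / (1 - th) + M * (th ^+ T * th ^+ k) =
    M * th ^+ T * (1 - th * th ^+ k) / (1 - th) by field; rewrite gt_eqF.
by [].
Qed.

Lemma rational_between (R : realType) (x e : R) : 0 < e -> exists q : rat, `|ratr q - x| <= e.
Proof.
move=> e0; have [|q] := @rat_in_itvoo R (x - e) (x + e); first by lra.
by rewrite in_itv/= => /andP[h1 h2]; exists q; rewrite ler_norml; lra.
Qed.

(* Lindelöf: countably many rational cubes suffice. *)
Lemma leb_outer_locally_null (R : realType) (d : nat) (A E : set 'rV[R]_d) :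
  (0 < d)%N ->
  (forall x, E x -> exists2 rho, 0 < rho & leb_outer (cube x rho `&` A) = 0%E) ->
  leb_outer (E `&` A) = 0%E.
Proof.
move=> d0 H.
pose Q (p : 'rV[rat]_d * nat) : set 'rV[R]_d := cube (map_mx ratr p.1) (p.2.+1%:R^-1).
(* Cubes on which [A] is not null are replaced by the empty set. *)
pose B m := if unpickle m is Some p then
  (if `[< leb_outer (Q p `&` A) = 0%E >] then Q p `&` A else set0) else set0.
apply: (@leb_outer_sub0 _ _ _ (\bigcup_m B m)); last first.
  apply: leb_outer_bigcup0 => m; rewrite /B; case: unpickle => [p|]; last exact: leb_outer0.
  by case: asboolP => // _; apply: leb_outer0.
move=> x [Ex Ax]; have [rho rho0 xA] := H x Ex.
pose k := Num.bound (2 / rho).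
have k0 : 0 < k.+1%:R :> R by rewrite ltr0n.
have krho : k.+1%:R^-1 * 2 <= rho.
  rewrite mulrC ler_pdivrMr// mulrC -ler_pdivrMr//; apply: ltW.
  apply: (@lt_le_trans _ _ k%:R); last by rewrite ler_nat.
  by apply: archi_boundP; rewrite divr_ge0// ltW.
have ik : 0 < k.+1%:R^-1 :> R by rewrite invr_gt0.
have [q qP] := choice (fun i => rational_between (x 0 i) ik).
pose p : 'rV[rat]_d * nat := (\row_i q i, k).
have Qx : Q p x by move=> i; rewrite /p !mxE distrC.
have Qsub : Q p `<=` cube x rho.
  move=> y yQ i; move: (yQ i) (Qx i) krho; rewrite /p !mxE; set u := k.+1%:R^-1; rewrite !ler_norml; lra.
have Q0 : leb_outer (Q p `&` A) = 0%E.
  by apply: leb_outer_sub0 xA => y [/Qsub].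
by exists (pickle p) => //; rewrite /B pickleK; case: asboolP.
Qed.

(** * The four implications *)

Section Main.
Variables (R : realType) (d n : nat) (U : set 'rV[R]_d) (f : 'rV[R]_d -> 'rV[R]_n).
Hypotheses (d0 : (0 < d)%N) (n0 : (0 < n)%N) (oU : open U) (fU : {in U, continuous f}).
Local Notation intmx := (@intmx R).

(** Halving the lower bound on the supremum gives an actual point of the ball, hence of the cube. *)
Lemma cond_star_large x0 rho beta : 0 < beta -> cond_star f (eball x0 rho) -> 0 <= rho ->
  exists T, forall t, T <= t -> forall s : node n, proper_minimal R s ->
    exists2 y, cube x0 rho y & expR (- (beta * t)) / 2 <= nnorm (gu t (f y)) s.
Proof.
move=> beta0 star rho0; have [T [T0 H]] := star _ beta0.
exists T => t Tt [j V] [/andP[/= j0 jn] [rV _]].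
have bV : is_basis R (int_span V) V by split.
have := H t Tt (int_span V) _ j V bV.
move=> /(_ _)/wrap[|le]; first by exists j, V.
have e0 := expR_gt0 (- (beta * t)).
have : ((expR (- (beta * t)) / 2)%:E < (expR (- (beta * t)))%:E)%E by rewrite lte_fin; lra.
move=> /lt_le_trans/(_ le)/ereal_sup_gt[_ [y yb <-]]; rewrite lte_fin => /ltW h.
by exists y => //; apply: eball_sub_cube yb.
Qed.

(** For each rate [1 / (k + 1)] the measures at integer times decay exponentially, so the limsup set
    is null; the rates are countably many. *)
Lemma locally_extremal x0 : U x0 -> good_at U f x0 ->
  (forall r : R, 0 < r -> exists rho : R, 0 < rho /\ rho < r /\ eball x0 rho `<=` U /\
     cond_star f (eball x0 rho)) ->
  exists2 rho, 0 < rho & leb_outer (cube x0 rho `&` [set x | VWA (f x)]) = 0%E.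
Proof.
move=> Ux0 [V [[oV Vx0 VU] [C [al [C0 [al0 fgood]]]]]] star.
have [R0 R00 R0V] := open_cube oV Vx0.
have d1 : 0 < 2 * d%:R + 1 :> R by rewrite ltr_wpDl// mulr_ge0.
have [|rho [rho0 [rhoR [_ srho]]]] := star (R0 / (2 * d%:R + 1)); first by rewrite divr_gt0.
have rootV : cube x0 ((2 * d%:R + 1) * rho) `<=` V.
  apply: subset_trans R0V => y yc i; apply: le_trans (yc i) _.
  by rewrite mulrC -ler_pdivlMr// ltW.
have rV : cube x0 rho `<=` V.
  apply: subset_trans rootV => y yc i; apply: le_trans (yc i) _.
  by rewrite ler_peMl ?(ltW rho0)// lerDr mulr_ge0.
have fcont x : cube x0 rho x -> {for x, continuous f}.
  by move=> xc; apply: fU; rewrite inE; apply/VU/rV.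
exists rho => //.
pose E (k t : nat) := [set x | cube x0 rho x /\ exists2 z : 'cV[int]_(1 + n), z != 0 &
  supnorm (gu t%:R (f x) *m intmx z) <= expR (- (k.+1%:R^-1 * t%:R))].
apply: (@leb_outer_sub0 _ _ _ (\bigcup_k [set x | forall T : nat, exists2 t, (T <= t)%N & E k t x])).
  move=> x [xc] /(short_vectors_of_VWA n0)[k kP]; exists k => // T.
  by have [t Tt [z z0 zs]] := kP T; exists t => //; split=> //; exists z.
apply: leb_outer_bigcup0 => k.
have g0 : 0 < k.+1%:R^-1 :> R by rewrite invr_gt0 ltr0n.
(* Half the rate: with [e] below, suprema are bounded below by [e / 2] and the short vectors have
   norm at most [e * e], so the ratio is of order [e]. *)
pose be : R := k.+1%:R^-1 / 2; have be0 : 0 < be by rewrite divr_gt0.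
pose K := dblconst d C al ^+ n.
have K1 : 1 <= K by rewrite exprn_ege1// dblconst_ge1.
have K0 : 0 < K by apply: lt_le_trans K1.
have [T HT] := cond_star_large be0 srho (ltW rho0).
pose L : R := 4 * n.+1%:R * K; have L0 : 0 < L by rewrite !mulr_gt0// ltr0n.
pose D : R := n%:R * dimconst d C * L `^ al * rho ^+ d.
have D0 : 0 <= D.
  by rewrite !mulr_ge0 ?exprn_ge0 ?powR_ge0 ?dimconst_ge0//; apply: ltW.
apply: (@borel_cantelli_exp R d (E k) (D + 1) (be * al) (maxn (Num.bound T) (Num.bound (L / be)))).
- by rewrite ltr_wpDl.
- by rewrite mulr_gt0.
move=> t; rewrite geq_max => /andP[tT tL].
have Tt : T <= t%:R.
  apply: le_trans (ler_norm _) _; apply: ltW.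
  apply: (@lt_le_trans _ _ (Num.bound T)%:R); last by rewrite ler_nat.
  by have := archi_boundP (normr_ge0 T); rewrite /Num.bound normr_id.
pose e := expR (- (be * t%:R)); have e0 : 0 < e by apply: expR_gt0.
have Le : L * e <= 1.
  rewrite /e expRN ler_pdivrMr ?expR_gt0// mul1r.
  apply: le_trans (expR_ge1Dx _); apply: (@le_trans _ _ (be * t%:R)); last by rewrite lerDr.
  rewrite mulrC -ler_pdivrMr//; apply: ltW.
  apply: (@lt_le_trans _ _ (Num.bound (L / be))%:R); last by rewrite ler_nat.
  by apply: archi_boundP; rewrite divr_ge0// ltW.
have ee : expR (- (k.+1%:R^-1 * t%:R)) = e * e.
  by rewrite -expRD; congr expR; rewrite /be; set u := k.+1%:R^-1; field.
have e1 : e <= 1 by rewrite expR_le1 oppr_le0 mulr_ge0// ltW.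
(* [K * rho1] is the available bound [e / 2], and [eps / (n + 1) = 2 * (e * e)] strictly exceeds the
   norms in question. *)
pose rho1 := e / (2 * K); pose eps := 2 * n.+1%:R * (e * e).
have n1 : 0 < n.+1%:R :> R by rewrite ltr0n.
have rho10 : 0 < rho1 by rewrite divr_gt0// mulr_gt0.
have eps0 : 0 < eps by rewrite !mulr_gt0.
have epsE : eps / rho1 = L * e.
  by rewrite /eps /rho1 /L; field; rewrite !gt_eqF.
have er : eps <= rho1 by rewrite -[leRHS]mul1r -ler_pdivrMr// epsE.
have KE : K * rho1 = e / 2 by rewrite /rho1; field; rewrite gt_eqF.
apply: (@le_trans _ _ (leb_outer [set x | cube x0 rho x /\ exists2 z : 'cV[int]_(1 + n), (z != 0)%R &
     (supnorm (gu t%:R (f x) *m intmx z) < eps / n.+1%:R)%R])).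
  apply: le_leb_outer => x [xc [z z0 zs]]; split=> //; exists z => //.
  apply: le_lt_trans zs _; rewrite ee /eps.
  have -> : 2 * n.+1%:R * (e * e) / n.+1%:R = 2 * (e * e) by field; rewrite gt_eqF.
  have : 0 < e * e by rewrite mulr_gt0.
  lra.
apply: le_trans (@short_vector_measure R d n f C al V d0 n0 C0 al0 fgood x0 rho rho0 rootV
  fcont t%:R rho1 eps eps0 er _ _) _.
- by rewrite -/K KE; lra.
- by move=> s /(HT _ Tt)[y yc ys]; exists y => //; rewrite -/K KE.
rewrite lee_fin epsE powRM ?(ltW L0) ?(ltW e0)// /e -expRM.
have -> : - (be * t%:R) * al = - (be * al * t%:R) by ring.
have -> : n%:R * (dimconst d C * (L `^ al * expR (- (be * al * t%:R)))) * rho ^+ d =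
  D * expR (- (be * al * t%:R)) by rewrite /D; ring.
by rewrite ler_pM2r ?expR_gt0// lerDl.
Qed.

Lemma extremal_of_star :
  good U f -> ae_in U (fun x0 => forall r : R, 0 < r ->
    exists rho : R, 0 < rho /\ rho < r /\ eball x0 rho `<=` U /\ cond_star f (eball x0 rho)) ->
  extremal U f.
Proof.
rewrite /good /extremal /ae_in.
pose P := fun x0 : 'rV[R]_d => forall r : R, 0 < r ->
  exists rho : R, 0 < rho /\ rho < r /\ eball x0 rho `<=` U /\ cond_star f (eball x0 rho).
rewrite -/P => gU sU.
pose N1 := [set x | U x /\ ~ good_at U f x]; pose N2 := [set x | U x /\ ~ P x].
pose W := [set x | VWA (f x)].
apply: (@leb_outer_sub0 _ _ _ (N1 `|` (N2 `|` ([set x | [/\ U x, good_at U f x & P x]] `&` W)))).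
  move=> x [Ux /contrapT Wx].
  have [gx|ngx] := pselect (good_at U f x); last by left.
  by have [px|npx] := pselect (P x); right; [right|left].
apply/eqP; rewrite eq_le leb_outer_ge0 andbT.
apply: (le_trans (leb_outerU _ _ d0)).
have -> : leb_outer N1 = 0%E by [].
rewrite add0e; apply: (le_trans (leb_outerU _ _ d0)).
have -> : leb_outer N2 = 0%E by [].
rewrite add0e (@leb_outer_locally_null R d)// => x [Ux gx px].
exact: locally_extremal.
Qed.

(** A covolume with small supremum over the ball is small at each of its points, and the
    Minkowski-type bound turns this into a short vector there. *)
Lemma VWA_of_not_star x r : ~ cond_star f (eball x r) ->
  forall y, eball x r y -> VWA (f y).
Proof.
rewrite /cond_star => /existsNP[beta] /not_implyP[beta0] /forallNP nT y yb.
have nR : 0 < n.+1%:R :> R by rewrite ltr0n.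
(* In rank at most [n + 1], minimum at least [expR (- gam * t)] forces covolume at least
   [kmin * expR (- beta * t / 2)]; the other half of [beta] absorbs [kmin]. *)
pose gam := beta / (2 * n.+1%:R).
have gam0 : 0 < gam by rewrite divr_gt0// mulr_gt0.
apply: (@VWA_of_short_vectors R n n0 _ gam gam0) => T.
have [kap kapP] : {kap : nat -> R & forall j, 0 < kap j /\
    forall N (M : 'M[R]_(N, j)) lam, 0 < lam ->
    (forall c : 'cV[int]_j, c != 0 -> lam <= supnorm (M *m intmx c)) ->
    kap j * lam ^+ j <= wedge_norm M}.
  apply: (@choice nat R (fun j k => 0 < k /\ forall N (M : 'M[R]_(N, j)) lam, 0 < lam ->
    (forall c : 'cV[int]_j, c != 0 -> lam <= supnorm (M *m intmx c)) ->
    k * lam ^+ j <= wedge_norm M)) => j.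
  by have [k k0 kP] := wedge_norm_lower_bound R j; exists k.
pose kmin := \big[Num.min/1]_(j < n.+2) kap j.
have kmin0 : 0 < kmin by apply: lt_bigmin => // j _; exact: (kapP j).1.
have kminle j : (j <= n.+1)%N -> kmin <= kap j.
  by move=> jn; apply: (bigmin_le _ (Ordinal (jn : (j < n.+2)%N))).
(* The last entry ensures [kmin >= expR (- beta * t / 2)] for [t >= T0]; the 1 makes [T0]
   positive. *)
pose T0 := Num.max (Num.max T 1) (2 * - ln kmin / beta).
have T00 : 0 < T0 by rewrite !lt_max ltr01 orbT.
have [t Tt [j [V [rV lt]]]] : exists2 t, T0 <= t & exists j (V : 'M[int]_(1 + n, j)),
    \rank (intmx V) = j /\ ~ ((expR (- (beta * t)))%:E <=
      ereal_sup [set (gGamma_norm (g_mx n t *m u_mx (f x)) V)%:E | x in eball x r])%E.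
  apply: contrapT => H; apply: (nT T0); split=> // t Tt G _ j V [rV _].
  by apply: contrapT => lt; apply: H; exists t => //; exists j, V.
have {}lt : wedge_norm (gu t (f y) *m intmx V) < expR (- (beta * t)).
  rewrite ltNge; apply/negP => le; apply: lt.
  apply: (@le_trans _ _ (wedge_norm (gu t (f y) *m intmx V))%:E); first by rewrite lee_fin.
  by apply: ereal_sup_ubound; exists y.
have t0 : 0 < t by apply: lt_le_trans Tt.
have jn : (j <= n.+1)%N by rewrite -rV; apply: rank_leq_row.
exists t; first by apply: le_trans Tt; rewrite !le_max lexx.
have [c c0 cs] : exists2 c : 'cV[int]_j, c != 0 &
    supnorm (gu t (f y) *m intmx V *m intmx c) < expR (- (gam * t)).
  apply: contrapT => /forall2NP H.
  have := (kapP j).2 _ (gu t (f y) *m intmx V) _ (expR_gt0 (- (gam * t))).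
  move=> /(_ _)/wrap[c c0|]; first by have [/negP//|/negP] := H c; rewrite -leNgt.
  apply/negP; rewrite -ltNge; apply: lt_le_trans lt _.
  apply: (@le_trans _ _ (kmin * expR (- (beta * t) / 2))).
    have kE : kmin = expR (ln kmin) by rewrite lnK.
    rewrite kE -expRD ler_expR.
    have : 2 * - ln kmin / beta <= t by apply: le_trans Tt; rewrite !le_max lexx !orbT.
    by rewrite ler_pdivrMr// mulrC; lra.
  apply: ler_pM; rewrite ?expR_ge0 ?(ltW kmin0) ?kminle//.
  rewrite -expRM_natl ler_expR.
  have : gam * (2 * n.+1%:R) = beta by rewrite divfK// gt_eqF// mulr_gt0.
  have : j%:R <= n.+1%:R :> R by rewrite ler_nat.
  have : 0 <= gam * t by rewrite mulr_ge0// ltW.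
  nra.
exists (V *m c); last by rewrite intmxM mulmxA.
apply: contra_neq c0 => Vc; apply/eqP; rewrite -(intmx_eq0 R) -trmx_eq0.
rewrite -(@mulmx_free_eq0 _ _ _ _ _ (intmx V)^T); last by rewrite /row_free mxrank_tr rV.
by rewrite -trmx_mul -intmxM Vc trmx_eq0 intmx_eq0.
Qed.

Lemma star_of_dense : U `<=` closure [set x | U x /\ ~ VWA (f x)] ->
  forall x r, 0 < r -> eball x r `<=` U -> cond_star f (eball x r).
Proof.
move=> dU x r r0 sub; apply: contrapT => nstar.
have d1 : 0 < 2 * d%:R :> R by rewrite mulr_gt0// ltr0n.
pose q := r / (2 * d%:R); have q0 : 0 < q by rewrite divr_gt0.
have qb : cube x q `<=` eball x r.
  have -> : r = 2 * d%:R * q by rewrite /q mulrC divfK// gt_eqF.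
  exact: cube_sub_eball.
have [y [[_ ny] yq]] := dU x (sub _ (qb _ (cube_center x (ltW q0)))) _ (cube_nbhs x q0).
by apply: ny; apply: VWA_of_not_star nstar y (qb _ yq).
Qed.

(** A cube has positive outer measure, so no neighborhood of a point of [U] can consist of
    exceptional points. *)
Lemma dense_of_extremal : extremal U f -> U `<=` closure [set x | U x /\ ~ VWA (f x)].
Proof.
move=> ext x Ux B Bx.
have UBx : nbhs x (U `&` B) by apply: filterI => //; apply: open_nbhs_nbhs.
have [del del0 sub] := nbhs_cube UBx.
apply: contrapT => /set0P/negP; rewrite negbK => /eqP empty.
have : leb_outer (cube x del) = 0%E.
  apply: leb_outer_sub0 ext => y /sub[Uy By]; split=> // ny.
  suff : (set0 : set 'rV[R]_d) y by [].
  by rewrite -empty.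
have := leb_outer_cube_ge x del0 => /[swap] ->.
by rewrite lee_fin leNgt exprn_gt0// mulr_gt0.
Qed.

Lemma star_ae_of_star : (forall x r, 0 < r -> eball x r `<=` U -> cond_star f (eball x r)) ->
  ae_in U (fun x0 => forall r : R, 0 < r ->
    exists rho : R, 0 < rho /\ rho < r /\ eball x0 rho `<=` U /\ cond_star f (eball x0 rho)).
Proof.
move=> star; apply: leb_outer_sub0 (leb_outer0 R d0) => x [Ux]; apply=> r r0.
have [del del0 sub] := open_cube oU Ux.
pose rho := Num.min del (r / 2).
have rho0 : 0 < rho by rewrite lt_min del0 divr_gt0.
have sub' : eball x rho `<=` U.
  apply: subset_trans sub => y /(eball_sub_cube (ltW rho0)) yc i.
  by apply: le_trans (yc i) _; rewrite ge_min lexx.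
exists rho; split=> //; split; last by split=> //; apply: star.
by rewrite gt_min; apply/orP; right; lra.
Qed.

End Main.

Lemma not_VWA0 (R : realType) (y : 'rV[R]_0) : ~ VWA y.
Proof.
move=> [v [_]]; apply; apply: (@sub_finite_set _ _ [set 0]); last exact: finite_set1.
by move=> q _; apply/matrixP => i [].
Qed.

(** No rank satisfies [0 < j < 1], so there is no subgroup to consider. *)
Lemma cond_star0 (R : realType) d (f : 'rV[R]_d -> 'rV[R]_0) B : cond_star f B.
Proof.
move=> beta _; exists 1; split=> // t _ G [j [V [j0 [j1 _]]]].
by move: (leq_trans j0 j1).
Qed.

Theorem theorem3p8 (R : realType) (d n : nat) (U : set 'rV[R]_d)
    (f : 'rV[R]_d -> 'rV[R]_n) :
  (0 < d)%N -> open U -> {in U, continuous f} -> good U f ->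
  [<-> U `<=` closure [set x | U x /\ ~ VWA (f x)];
       extremal U f;
       ae_in U (fun x0 => forall r : R, 0 < r ->
         exists rho : R, 0 < rho /\ rho < r /\ eball x0 rho `<=` U /\
           cond_star f (eball x0 rho));
       forall (x : 'rV[R]_d) (r : R), 0 < r -> eball x r `<=` U ->
         cond_star f (eball x r)].
Proof.
(* The cycle is (i) => (iv) => (iii) => (ii) => (i). *)
move=> d0 oU fU gU.
have iv_iii := @star_ae_of_star R d n U f d0 oU.
have ii_i := @dense_of_extremal R d n U f oU.
have [i_iv iii_ii] : (U `<=` closure [set x | U x /\ ~ VWA (f x)] ->
     forall x r, 0 < r -> eball x r `<=` U -> cond_star f (eball x r)) /\
   (ae_in U (fun x0 => forall r : R, 0 < r -> exists rho : R, 0 < rho /\ rho < r /\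
     eball x0 rho `<=` U /\ cond_star f (eball x0 rho)) -> extremal U f).
  (* For [n = 0] the matrix [gu t y] has determinant [expR t] instead of 1, and both implications
     hold trivially. *)
  have [n0|n0] := posnP n; last by split; [exact: star_of_dense | exact: extremal_of_star].
  subst n; split=> [_ x r _ _|_]; first exact: cond_star0.
  apply: leb_outer_sub0 (leb_outer0 R d0) => x [_]; apply; exact: not_VWA0.
tfae; auto.
Qed.
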